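(* Let $a,b,c$ be positive numbers with $a<b<c$, and set $c_0=c-\lfloor c/b\rfloor b$. (VI) Suppose $c_0\ge a$ and $c_0>b-a$. Then $\mathcal G(\chi_{[0,c)},a\mathbb Z\times\mathbb Z/b)$ is not a Gabor frame if and only if $a/b=p/q$ for some coprime positive integers $p,q$ and one of the following holds: 1) $c_0>b-\gcd(\lfloor c/b\rfloor+1,p)\,b/q$ and $\gcd(\lfloor c/b\rfloor+1,p)\ne\lfloor c/b\rfloor+1$; 2) $c_0>b-\gcd(\lfloor c/b\rfloor+1,p)\,b/q+b/q$ and $\gcd(\lfloor c/b\rfloor+1,p)=\lfloor c/b\rfloor+1$. (VII) Suppose $c_0<a$ and $c_0\le b-a$. Then $\mathcal G(\chi_{[0,c)},a\mathbb Z\times\mathbb Z/b)$ is not a Gabor frame if and only if one of the following holds: 3) $c_0=0$; 4) $a/b=p/q$ for some coprime positive integers $p,q$, $0<c_0<\gcd(\lfloor c/b\rfloor,p)\,b/q$, and $\gcd(\lfloor c/b\rfloor,p)\ne\lfloor c/b\rfloor$; 5) $a/b=p/q$ for some coprime positive integers $p,q$, $0<c_0<\gcd(\lfloor c/b\rfloor,p)\,b/q-b/q$, and $\gcd(\lfloor c/b\rfloor,p)=\lfloor c/b\rfloor$.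
   Context: For $\phi\in L^2(\mathbb R)$ and $a,b>0$, the Gabor system is $\mathcal G(\phi,a\mathbb Z\times\mathbb Z/b)=\{e^{-2\pi i n t/b}\phi(t-ma): (m,n)\in\mathbb Z\times\mathbb Z\}$. It is called a Gabor frame if it is a frame for $L^2(\mathbb R)$: there are constants $0<A\le B<\infty$ such that $A\|f\|_2^2\le\sum_{\psi\in\mathcal G}|\langle f,\psi\rangle|^2\le B\|f\|_2^2$ for all $f\in L^2(\mathbb R)$. $\chi_E$ is the indicator function of $E$, $\lfloor x\rfloor$ is the integer part of $x$, and $\gcd$ of two positive integers is their usual greatest common divisor. *)

(* Defs.v *)
From HB Require Import structures.
From mathcomp Require Import all_boot all_order all_algebra.
From mathcomp Require Import all_classical all_reals all_analysis.
Set Implicit Arguments. Unset Strict Implicit. Unset Printing Implicit Defensive.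
Import Order.TTheory GRing.Theory Num.Theory.
Import numFieldNormedType.Exports.
Local Open Scope classical_set_scope.
Local Open Scope ring_scope.

(* A complex-valued function f = u + i v on R is encoded by its real and
   imaginary parts u, v : R -> R. *)

Section Gabor.
Variable R : realType.
Local Notation leb := (@lebesgue_measure R).

Definition L2 (u v : R -> R) : Prop :=
  [/\ measurable_fun setT u, measurable_fun setT v &
      (\int[leb]_x (((u x) ^+ 2 + (v x) ^+ 2)%:E) < +oo)%E].

Definition L2normsq (u v : R -> R) : \bar R :=
  (\int[leb]_x (((u x) ^+ 2 + (v x) ^+ 2)%:E))%E.

(* Gabor atom psi_{m,n}(t) = e^{-2 pi i n t / b} phi(t - m a), phi = phr + i phi,
   given by real part and imaginary part. *)
Definition gabor_re (phr phi : R -> R) (a b : R) (m n : int) (t : R) : R :=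
  let th := 2 * pi * n%:~R * t / b in
  cos th * phr (t - m%:~R * a) + sin th * phi (t - m%:~R * a).
Definition gabor_im (phr phi : R -> R) (a b : R) (m n : int) (t : R) : R :=
  let th := 2 * pi * n%:~R * t / b in
  cos th * phi (t - m%:~R * a) - sin th * phr (t - m%:~R * a).

(* <f, psi> = \int f * conj psi, with f = u + i v, psi = pr + i pi:
   real part \int (u pr + v pi), imaginary part \int (v pr - u pi). *)
Definition inner_re (u v pr pim : R -> R) : R :=
  Rintegral leb setT (fun t => u t * pr t + v t * pim t).
Definition inner_im (u v pr pim : R -> R) : R :=
  Rintegral leb setT (fun t => v t * pr t - u t * pim t).

Definition gabor_coeff_sq (phr phi : R -> R) (a b : R) (u v : R -> R)
  (mn : int * int) : \bar R :=
  let pr := gabor_re phr phi a b mn.1 mn.2 in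
  let pim := gabor_im phr phi a b mn.1 mn.2 in
  ((inner_re u v pr pim) ^+ 2 + (inner_im u v pr pim) ^+ 2)%:E.

Definition gabor_frame (phr phi : R -> R) (a b : R) : Prop :=
  exists A B : R, [/\ 0 < A, A <= B &
    forall u v : R -> R, L2 u v ->
      (A%:E * L2normsq u v <= \esum_(mn in [set: int * int])
                                 gabor_coeff_sq phr phi a b u v mn)%E /\
      (\esum_(mn in [set: int * int]) gabor_coeff_sq phr phi a b u v mn
         <= B%:E * L2normsq u v)%E].

Definition chi0c (c : R) (t : R) : R := if (0 <= t) && (t < c) then 1 else 0.

End Gabor.

(* Main.v *)
Require Import Defs.
From HB Require Import structures.
From mathcomp Require Import all_boot all_order all_algebra.
From mathcomp Require Import all_classical all_reals all_analysis.
From mathcomp Require Import measurable_realfun ring lra zify.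
Set Implicit Arguments. Unset Strict Implicit. Unset Printing Implicit Defensive.
Import Order.TTheory GRing.Theory Num.Theory.
Import numFieldNormedType.Exports.
Local Open Scope classical_set_scope.
Local Open Scope ring_scope.

(** Pairing the frequencies [n] and [-n] reduces everything to real-valued [u].
For fixed [m] the coefficients of [u] are the Fourier coefficients, on a period
[[ma, ma + b)], of the periodization [G_m] of [u * chi_[ma, ma + c)].  Two-sided
bounds between the sum of their squares and the energy [\int G_m ^ 2] therefore
turn the frame property into a lower bound of [\sum_m \int G_m ^ 2] by [\int u ^ 2].

With [N = k + 1], [ep = b - c0] in case (VI) and [N = k], [ep = c0] in case (VII),
the difference [G_m - G_(m+1)] is [u t] when [t] is in the bad set, a union of
intervals of length [ep] repeated with period [a], and [u t - u (t + N b)]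
otherwise.  If the orbit of [t] under translation by [N b] meets the bad set in
boundedly many steps, [u t] is controlled by these differences.  This holds for all
[t] when [a / b] is irrational (pigeonhole), and when [a / b = p / q] as soon as [ep]
is at least the spacing [gcd(N, p) b / q] of the orbits modulo [a].  It is enough that
among [t, t + b, ..., t + (N - 1) b] at most one orbit misses the bad set, because
[G_m t] is the sum of [u] over these [N] points.

Conversely, when the orbits of two points [t] and [t + r b], [0 < r < N], miss the
bad set, the function taking the values [1] and [-1] on [J] successive translates of
small intervals at these two points has window sums vanishing except near its two
ends, so its energy stays bounded while its norm grows with [J]. *)

(** * Square-integrable functions on the line *)

(** The alternative on [gcdn N p] reflects how the points [t + r b], [0 <= r < N], fall into residue
    classes. Put [w = b / q], so that [a = p w] and [b = q w]: the orbit of [t] modulo [a] is a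
    class of spacing [d w], with [d = gcd(N, p)]. If [d < N], then [t] and [t + d b] lie in the same
    class, hence miss the bad set together. If [d = N], then [N] is prime to [q] and the [N] points
    occupy [N] different classes, whose offsets are multiples of [w]; two of them are missed
    together most easily when they are adjacent, and this costs the extra [b / q].

    The lower Fourier bound contains the completeness of the trigonometric system. It is reached
    through the discrete Fourier transform: Parseval's identity on step functions with [2 K + 1]
    cells and frequencies [-K, ..., K] loses only a factor independent of [K], so the bound survives
    the limit given by density of step functions. Constants are not optimized, since only the
    existence of frame bounds is at stake. *)

Section Shift.
Variable R : realType.
Local Notation mu := (@lebesgue_measure R).
Implicit Types (s : R) (D : set R).

Lemma measurable_shift s : measurable_fun [set: R] (fun x : R => x + s).
Proof. by apply: measurable_funD => //; exact: measurable_cst. Qed.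

(** Lebesgue measure is determined by its values on half-open intervals, whose lengths a translation
    preserves. *)
Lemma lebesgue_measure_shift s (A : set R) : measurable A ->
  pushforward mu (fun x : measurableTypeR R => (x + s : measurableTypeR R)) A = mu A.
Proof.
move=> mA.
have mphi : measurable_fun setT (fun x : measurableTypeR R => (x + s : measurableTypeR R)).
  exact: measurable_shift.
pose mphi_mixin := isMeasurableFun.Build _ _ _ _ _ mphi.
pose phi : {mfun _ >-> _} := HB.pack (fun x : measurableTypeR R => (x + s : measurableTypeR R)) mphi_mixin.
apply/esym/(@lebesgue_measure_unique _ (pushforward mu phi)) => //= _ [[x y]] _ <-.
rewrite /pushforward.
rewrite (_ : _ @^-1` _ = `](x - s), (y - s)]%classic); last first.
  by apply/seteqP; split => z /=; rewrite !in_itv/=; lra.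
rewrite !lebesgue_measure_itv/= !lte_fin ltrD2r.
by case: ifP => // _; rewrite -!EFinB; congr EFin; ring.
Qed.

Lemma ge0_integral_shift s D (f : R -> \bar R) :
  measurable D -> measurable_fun D f -> (forall x, D x -> 0 <= f x)%E ->
  (\int[mu]_(x in D) f x = \int[mu]_(x in [set x : R | D (x + s)%R]) f (x + s)%R)%E.
Proof.
move=> mD mf f0.
have mphi : measurable_fun [set: measurableTypeR R]
  (fun x : measurableTypeR R => (x + s : measurableTypeR R)) by exact: measurable_shift.
have := @ge0_integral_pushforward _ _ _ _ _ _ mphi (@lebesgue_measure R) D f mD mf.
move=> <-; last by move=> x; rewrite inE; exact: f0.
by apply: eq_measure_integral => //= A mA AS; exact/esym/lebesgue_measure_shift.
Qed.

Lemma integral_shift s D (f : R -> \bar R) :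
  measurable D -> measurable_fun D f ->
  (\int[mu]_(x in D) f x = \int[mu]_(x in [set x : R | D (x + s)%R]) f (x + s)%R)%E.
Proof.
move=> mD mf; rewrite [LHS]integralE [RHS]integralE.
have mp := measurable_funepos mf; have mn := measurable_funeneg mf.
congr (_ - _)%E.
  rewrite (ge0_integral_shift s mD mp (fun x _ => funepos_ge0 f x)).
  by apply: eq_integral => x _; rewrite !funeposE.
rewrite (ge0_integral_shift s mD mn (fun x _ => funeneg_ge0 f x)).
by apply: eq_integral => x _; rewrite !funenegE.
Qed.

End Shift.

Section SquareIntegrable.
Variable R : realType.
Local Notation mu := (@lebesgue_measure R).
Implicit Types (D : set R) (F G : R -> R).

Definition sqint D F := measurable_fun D F /\
  (\int[mu]_(x in D) ((F x) ^+ 2)%:E < +oo)%E.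

Definition ip D F G : R := \int[mu]_(x in D) (F x * G x).

Variable D : set R.
Hypothesis mD : measurable D.

Lemma measurable_sqr F : measurable_fun D F ->
  measurable_fun D (fun x => ((F x) ^+ 2)%:E).
Proof. by move=> mF; apply/measurable_EFinP; exact: measurable_funX. Qed.

Lemma sqr_integrable F : sqint D F -> mu.-integrable D (fun x => ((F x) ^+ 2)%:E).
Proof.
move=> [mF iF]; apply/integrableP; split; first exact: measurable_sqr.
by under eq_integral do rewrite gee0_abs ?lee_fin ?sqr_ge0//.
Qed.

Lemma sqint_le F G H : measurable_fun D F -> sqint D G -> sqint D H ->
  (forall x, D x -> (F x) ^+ 2 <= (G x) ^+ 2 + (H x) ^+ 2) -> sqint D F.
Proof.
move=> mF sG sH FG; split=> //.
have [mG iG] := sG; have [mH iH] := sH.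
have := lte_add_pinfty iG iH; apply: le_lt_trans.
rewrite -ge0_integralD//.
- apply: ge0_le_integral => //.
  + by move=> x _; rewrite lee_fin sqr_ge0.
  + exact: measurable_sqr.
  + by apply: emeasurable_funD; exact: measurable_sqr.
- by move=> x _; rewrite lee_fin sqr_ge0.
- exact: measurable_sqr.
- by move=> x _; rewrite lee_fin sqr_ge0.
- exact: measurable_sqr.
Qed.

Lemma sqintZ r F : sqint D F -> sqint D (fun x => r * F x).
Proof.
move=> [mF iF]; split; first by apply: measurable_funM => //; exact: measurable_cst.
under eq_integral do rewrite exprMn EFinM.
rewrite ge0_integralZl//.
- by rewrite lte_mul_pinfty// lee_fin sqr_ge0.
- exact: measurable_sqr.
- by move=> x _; rewrite lee_fin sqr_ge0.
- by rewrite lee_fin sqr_ge0.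
Qed.

Lemma sqintD F G : sqint D F -> sqint D G -> sqint D (fun x => F x + G x).
Proof.
move=> sF sG; have [mF _] := sF; have [mG _] := sG.
apply: (sqint_le _ (sqintZ 2 sF) (sqintZ 2 sG)); first exact: measurable_funD.
by move=> x _; have := sqr_ge0 (F x); have := sqr_ge0 (G x);
  have := sqr_ge0 (F x - G x); lra.
Qed.

Lemma sqintB F G : sqint D F -> sqint D G -> sqint D (fun x => F x - G x).
Proof.
move=> sF sG; rewrite (_ : (fun x => _) = (fun x => F x + (-1) * G x)).
  by apply: sqintD => //; exact: sqintZ.
by apply/funext => x; rewrite mulN1r.
Qed.

Lemma sqint0 : sqint D (fun=> 0).
Proof.
split; first exact: measurable_cst.
by under eq_integral do rewrite expr0n/=; rewrite integral0.
Qed.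

Lemma sqint_sum (I : Type) (s : seq I) (phi : I -> R -> R) :
  (forall i, sqint D (phi i)) -> sqint D (fun x => \sum_(i <- s) phi i x).
Proof.
move=> sp; elim: s => [|i s ih].
  by under [X in sqint _ X]eq_fun do rewrite big_nil; exact: sqint0.
by under [X in sqint _ X]eq_fun do rewrite big_cons; exact: sqintD.
Qed.

Lemma sqint_bounded F (M : R) : (mu D < +oo)%E -> measurable_fun D F ->
  (forall x, D x -> `|F x| <= M) -> sqint D F.
Proof.
move=> muD mF FM; split=> //.
apply: (@le_lt_trans _ _ (\int[mu]_(x in D) (cst (M ^+ 2)%:E) x)%E).
  apply: ge0_le_integral => //.
  + by move=> x _; rewrite lee_fin sqr_ge0.
  + exact: measurable_sqr.
  + by move=> x Dx; rewrite /= lee_fin -[leLHS]real_normK ?num_real// lerXn2r ?nnegrE ?FM// (le_trans _ (FM _ Dx)).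
by rewrite integral_cst// lte_mul_pinfty// lee_fin sqr_ge0.
Qed.

Lemma mul_integrable F G : sqint D F -> sqint D G ->
  mu.-integrable D (EFin \o (fun x => F x * G x)).
Proof.
move=> sF sG; have [mF _] := sF; have [mG _] := sG.
apply: (@le_integrable _ (measurableTypeR R) R mu D _ _
  (fun x => ((F x) ^+ 2)%:E + ((G x) ^+ 2)%:E)%E).
- exact: mD.
- by apply/measurable_EFinP; exact: measurable_funM.
- move=> x _ /=; rewrite lee_fin.
  rewrite [leRHS]ger0_norm ?addr_ge0 ?sqr_ge0//.
  rewrite ler_norml; have := sqr_ge0 (F x); have := sqr_ge0 (G x).
  by have := sqr_ge0 (F x - G x); have := sqr_ge0 (F x + G x); lra.
- by apply: integrableD => //; exact: sqr_integrable.
Qed.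

Lemma ipC F G : ip D F G = ip D G F.
Proof. by rewrite /ip; under eq_Rintegral do rewrite mulrC. Qed.

Lemma ipDr F G H : sqint D F -> sqint D G -> sqint D H ->
  ip D F (fun x => G x + H x) = ip D F G + ip D F H.
Proof.
move=> sF sG sH; rewrite /ip; under eq_Rintegral do rewrite mulrDr.
by rewrite RintegralD//; exact: mul_integrable.
Qed.

Lemma ipZr r F G : sqint D F -> sqint D G ->
  ip D F (fun x => r * G x) = r * ip D F G.
Proof.
move=> sF sG; rewrite /ip; under eq_Rintegral do rewrite mulrCA.
by rewrite RintegralZl//; exact: mul_integrable.
Qed.

Lemma ip0r F : ip D F (fun=> 0) = 0.
Proof.
rewrite /ip; under eq_Rintegral do rewrite mulr0.
by rewrite /Rintegral integral0.
Qed.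

Lemma ip_sumr (I : Type) (s : seq I) (phi : I -> R -> R) F : sqint D F ->
  (forall i, sqint D (phi i)) ->
  ip D F (fun x => \sum_(i <- s) phi i x) = \sum_(i <- s) ip D F (phi i).
Proof.
move=> sF sp; elim: s => [|i s ih].
  by rewrite big_nil; under [X in ip _ _ X]eq_fun do rewrite big_nil; exact: ip0r.
under [X in ip _ _ X]eq_fun do rewrite big_cons.
by rewrite ipDr// ?ih ?big_cons//; exact: sqint_sum.
Qed.

Lemma ip_ge0 F : 0 <= ip D F F.
Proof. by apply: Rintegral_ge0 => x _; rewrite -expr2 sqr_ge0. Qed.

Lemma ipE F : sqint D F -> (ip D F F)%:E = (\int[mu]_(x in D) ((F x) ^+ 2)%:E)%E.
Proof.
move=> sF; rewrite /ip /Rintegral fineK.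
  by apply: eq_integral => x _; rewrite -expr2.
by apply: integrable_fin_num => //; exact: mul_integrable.
Qed.

Lemma ip_sqrD F G (r : R) : sqint D F -> sqint D G ->
  ip D (fun x => F x + r * G x) (fun x => F x + r * G x) =
  ip D F F + 2 * r * ip D F G + r ^+ 2 * ip D G G.
Proof.
move=> sF sG; have srG := sqintZ r sG; have sS := sqintD sF srG.
have e1 : ip D (fun x => F x + r * G x) F = ip D F F + r * ip D F G.
  by rewrite ipC ipDr// ipZr.
have e2 : ip D (fun x => F x + r * G x) G = ip D F G + r * ip D G G.
  by rewrite ipC ipDr// ipZr// (ipC G F).
by rewrite ipDr// ipZr// e1 e2; ring.
Qed.

(** Expand the nonnegative square norm of [F - B^-1 * sum x_i phi_i], where [x_i] are the
    coefficients of [F]. A bound on the Gram form takes the place of orthogonality, which fails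
    below because the indices [n] and [- n] carry the same cosine. *)
Lemma bessel (I : Type) (s : seq I) (phi : I -> R -> R) (B : R) F : 0 < B ->
  sqint D F -> (forall i, sqint D (phi i)) ->
  (forall x : I -> R, ip D (fun t => \sum_(i <- s) x i * phi i t)
                           (fun t => \sum_(i <- s) x i * phi i t)
                      <= B * \sum_(i <- s) (x i) ^+ 2) ->
  \sum_(i <- s) (ip D F (phi i)) ^+ 2 <= B * ip D F F.
Proof.
move=> B0 sF sp gram; pose x i := ip D F (phi i).
have sxp i : sqint D (fun t => x i * phi i t) by exact: sqintZ.
have sP := sqint_sum s sxp.
have := ip_ge0 (fun t => F t + - B^-1 * (\sum_(i <- s) x i * phi i t)).
rewrite ip_sqrD// ip_sumr//; under eq_bigr do rewrite ipZr// -/(x _) -expr2.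
have := gram x; rewrite -/x; set E := \sum_(i <- s) _; set Q := ip _ _ _.
move=> QE h.
have h2 : B^-1 ^+ 2 * Q <= B^-1 * E.
  rewrite (le_trans (ler_wpM2l (sqr_ge0 _) QE))// expr2 -mulrA (mulrA _ B) mulVf ?gt_eqF//.
  by rewrite mul1r.
have h3 : B^-1 * E <= ip D F F by rewrite sqrrN in h; lra.
by rewrite -(ler_pM2l (_ : 0 < B^-1)) ?invr_gt0// mulrA mulVf ?gt_eqF// mul1r.
Qed.

End SquareIntegrable.

(** * Fourier coefficients on a period *)

Section Trig.
Variable R : realType.
Local Notation mu := (@lebesgue_measure R).
Implicit Types (th x y t : R).

Lemma is_derive_sinZ th t : is_derive t 1 (fun x => sin (th * x)) (th * cos (th * t)).
Proof.
rewrite mulrC; apply: (@is_derive1_comp _ sin ( *%R th)).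
rewrite -[X in is_derive _ _ _ X](mulr1 th).
exact: (is_deriveZ _ (is_derive_id _ _)).
Qed.

Lemma is_derive_cosZ th t : is_derive t 1 (fun x => cos (th * x)) (- th * sin (th * t)).
Proof.
rewrite mulNr -mulrN mulrC; apply: (@is_derive1_comp _ cos ( *%R th)).
rewrite -[X in is_derive _ _ _ X](mulr1 th).
exact: (is_deriveZ _ (is_derive_id _ _)).
Qed.

Lemma continuous_sinZ th : continuous (fun t => sin (th * t)).
Proof.
by move=> t; apply: differentiable_continuous; apply/derivable1_diffP; apply: ex_derive;
  exact: is_derive_sinZ.
Qed.

Lemma continuous_cosZ th : continuous (fun t => cos (th * t)).
Proof.
by move=> t; apply: differentiable_continuous; apply/derivable1_diffP; apply: ex_derive;
  exact: is_derive_cosZ.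
Qed.

Lemma measurable_sinZ th D : measurable_fun D (fun t => sin (th * t)).
Proof. by apply: measurable_funTS; apply: continuous_measurable_fun; exact: continuous_sinZ. Qed.

Lemma measurable_cosZ th D : measurable_fun D (fun t => cos (th * t)).
Proof. by apply: measurable_funTS; apply: continuous_measurable_fun; exact: continuous_cosZ. Qed.

Lemma itv_co_fin x y : (mu `[x, y[%classic < +oo)%E.
Proof. by rewrite lebesgue_measure_itv/=; case: ifP => _; rewrite -?EFinB ltry. Qed.

Lemma sqint_cos th x y : sqint `[x, y[ (fun t => cos (th * t)).
Proof.
apply: (@sqint_bounded _ _ _ _ 1) => //; first exact: itv_co_fin.
- exact: measurable_cosZ.
- by move=> t _; rewrite ler_norml cos_geN1 cos_le1.
Qed.

Lemma sqint_sin th x y : sqint `[x, y[ (fun t => sin (th * t)).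
Proof.
apply: (@sqint_bounded _ _ _ _ 1) => //; first exact: itv_co_fin.
- exact: measurable_sinZ.
- by move=> t _; rewrite ler_norml sin_geN1 sin_le1.
Qed.

Lemma sqint_cst x y (r : R) : sqint `[x, y[ (fun=> r).
Proof.
by apply: (@sqint_bounded _ _ _ _ `|r|) => //; first exact: itv_co_fin.
Qed.

Lemma integrable_cos th x y : mu.-integrable `[x, y[ (EFin \o (fun t => cos (th * t))).
Proof.
have := mul_integrable (measurable_itv _) (sqint_cst x y 1) (sqint_cos th x y).
by apply: eq_integrable => // t _ /=; rewrite mul1r.
Qed.

Lemma integrable_sin th x y : mu.-integrable `[x, y[ (EFin \o (fun t => sin (th * t))).
Proof.
have := mul_integrable (measurable_itv _) (sqint_cst x y 1) (sqint_sin th x y).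
by apply: eq_integrable => // t _ /=; rewrite mul1r.
Qed.

Lemma Rintegral_FTC (f F : R -> R) x y : x <= y -> continuous f ->
  (forall t, is_derive t 1 F (f t)) ->
  \int[mu]_(t in `[x, y[) f t = F y - F x.
Proof.
rewrite le_eqVlt => /predU1P[<-|xy] cf dF.
  by rewrite set_itvco0 Rintegral_set0 subrr.
have cF : continuous F.
  move=> t; apply: differentiable_continuous; apply/derivable1_diffP.
  exact: ex_derive.
rewrite /Rintegral integral_itv_bndo_bndc; last first.
  apply: measurable_funTS; apply/measurable_EFinP.
  exact: continuous_measurable_fun.
rewrite (@continuous_FTC2 _ f F)//.
- exact: continuous_subspaceT.
- split.
  + by move=> t _; exact: ex_derive.
  + by apply: cvg_at_right_filter; exact: cF.
  + by apply: cvg_at_left_filter; exact: cF.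
- by move=> t _; rewrite derive1E; exact: derive_val.
Qed.

Lemma Rintegral_cos th x y : x <= y ->
  th * \int[mu]_(t in `[x, y[) cos (th * t) = sin (th * y) - sin (th * x).
Proof.
move=> xy; rewrite -RintegralZl//; last exact: integrable_cos.
apply: (@Rintegral_FTC (fun t => th * cos (th * t)) (fun t => sin (th * t))) => //.
  by move=> t; apply: cvgM; [exact: cvg_cst|exact: continuous_cosZ].
by move=> t; exact: is_derive_sinZ.
Qed.

Lemma Rintegral_sin th x y : x <= y ->
  th * \int[mu]_(t in `[x, y[) sin (th * t) = cos (th * x) - cos (th * y).
Proof.
move=> xy; rewrite -[LHS]opprK -mulNr -RintegralZl//; last exact: integrable_sin.
rewrite -opprB; congr (- _).
apply: (@Rintegral_FTC (fun t => - th * sin (th * t)) (fun t => cos (th * t))) => //.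
  by move=> t; apply: cvgM; [exact: cvg_cst|exact: continuous_sinZ].
by move=> t; exact: is_derive_cosZ.
Qed.

Lemma cosD2pin x (n : int) : cos (x + 2 * pi * n%:~R) = cos x.
Proof.
have H (m : nat) (z : R) : cos (z + 2 * pi * m%:R) = cos z.
  rewrite -[RHS](@periodicn _ _ cos (pi *+ 2) (@cosD2pi R) m z).
  by congr cos; rewrite mulr_natr mulr_natl.
case: n => m; first exact: H.
by rewrite NegzE mulrNz mulrN -[LHS](H m.+1) subrK.
Qed.

Lemma sinD2pin x (n : int) : sin (x + 2 * pi * n%:~R) = sin x.
Proof.
by rewrite -[LHS]cosBpihalf addrAC cosD2pin cosBpihalf.
Qed.

End Trig.

Section FourierBessel.
Variables (R : realType) (b al : R).
Hypothesis b_gt0 : 0 < b.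
Local Notation mu := (@lebesgue_measure R).
Local Notation D := (`[al, al + b[%classic : set R).

Definition freq (n : int) : R := 2 * pi * n%:~R / b.

Lemma freqD n m : freq (n + m) = freq n + freq m.
Proof. by rewrite /freq intrD; ring. Qed.

Lemma freqN n : freq (- n) = - freq n.
Proof. by rewrite /freq mulrNz mulrN mulNr. Qed.

Lemma freqb n : freq n * b = 2 * pi * n%:~R.
Proof. by rewrite /freq mulfVK ?gt_eqF. Qed.

Lemma freq_eq0 n : (freq n == 0) = (n == 0).
Proof.
rewrite /freq !mulf_eq0 invr_eq0 (gt_eqF b_gt0) orbF intr_eq0.
by rewrite pnatr_eq0 (gt_eqF (pi_gt0 R)).
Qed.

Let le_D : al <= al + b. Proof. by rewrite lerDl ltW. Qed.

Lemma Rintegral_cos_period n :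
  \int[mu]_(t in D) cos (freq n * t) = b * (n == 0)%:R.
Proof.
have [->|n0] := eqVneq n 0.
  rewrite mulr1; under eq_Rintegral do rewrite /freq mulr0z mulr0 !mul0r cos0.
  rewrite Rintegral_cst//= mul1r lebesgue_measure_itv/= lte_fin ltrDl b_gt0.
  by rewrite -EFinB/=; ring.
rewrite mulr0; apply: (@mulfI _ (freq n)); first by rewrite freq_eq0.
by rewrite Rintegral_cos// mulrDr freqb sinD2pin subrr mulr0.
Qed.

Lemma ip_cos_cos n m : ip D (fun t => cos (freq n * t)) (fun t => cos (freq m * t))
  = b / 2 * ((m == n)%:R + (m == - n)%:R).
Proof.
rewrite /ip.
under eq_Rintegral => t _.
  rewrite (_ : _ * _ = 2^-1 * cos (freq (n - m) * t) + 2^-1 * cos (freq (n + m) * t)); last first.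
    by rewrite !freqD freqN !mulrDl mulNr cosB cosD; field.
  over.
have h k : mu.-integrable D (EFin \o (fun t => 2^-1 * cos (freq k * t))).
  exact: (mul_integrable (measurable_itv _) (sqint_cst _ _ _) (sqint_cos _ _ _)).
rewrite RintegralD// !RintegralZl//; do ?exact: integrable_cos.
rewrite !Rintegral_cos_period subr_eq0 addr_eq0 (eq_sym n m) (eq_sym n (- m)) eqr_oppLR.
by field.
Qed.

Lemma ip_sin_sin n m : ip D (fun t => sin (freq n * t)) (fun t => sin (freq m * t))
  = b / 2 * ((m == n)%:R - (m == - n)%:R).
Proof.
rewrite /ip.
under eq_Rintegral => t _.
  rewrite (_ : _ * _ = 2^-1 * cos (freq (n - m) * t) + (- 2^-1) * cos (freq (n + m) * t)); last first.
    by rewrite !freqD freqN !mulrDl mulNr cosB cosD; field.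
  over.
have h k r : mu.-integrable D (EFin \o (fun t => r * cos (freq k * t))).
  exact: (mul_integrable (measurable_itv _) (sqint_cst _ _ _) (sqint_cos _ _ _)).
rewrite RintegralD// !RintegralZl//; do ?exact: integrable_cos.
rewrite !Rintegral_cos_period subr_eq0 addr_eq0 (eq_sym n m) (eq_sym n (- m)) eqr_oppLR.
by field.
Qed.

(** Use [2 e x_n x_m <= x_n ^ 2 + x_m ^ 2]; by injectivity of [f], each row and each column of the
    matrix [(m == f n)] holds at most one nonzero entry. *)
Lemma sum_pair_le (s : seq int) (f : int -> int) (x : int -> R) (e : R) :
  uniq s -> injective f -> e ^+ 2 = 1 ->
  \sum_(n <- s) \sum_(m <- s) e * (x n * x m) * (m == f n)%:R
  <= \sum_(n <- s) (x n) ^+ 2.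
Proof.
move=> us fi e2.
have cnt (z : int) : \sum_(m <- s) (m == z)%:R <= 1 :> R.
  rewrite -natr_sum -(big_mkcond (fun m => m == z) (fun=> 1%N)) sum1_count.
  by rewrite count_uniq_mem// lern1 leq_b1.
have cnt2 (z : int) : \sum_(n <- s) (z == f n)%:R <= 1 :> R.
  rewrite -natr_sum -(big_mkcond (fun n => z == f n) (fun=> 1%N)) sum1_count.
  rewrite lern1 -(count_map f (fun y => z == y)) (eq_count (a2 := pred1 z)); last first.
    by move=> y; rewrite /= eq_sym.
  by rewrite count_uniq_mem ?map_inj_uniq// leq_b1.
apply: (@le_trans _ _ (\sum_(n <- s) \sum_(m <- s)
   ((x n) ^+ 2 / 2 * (m == f n)%:R + (x m) ^+ 2 / 2 * (m == f n)%:R))).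
  apply: ler_sum => n _; apply: ler_sum => m _; rewrite -mulrDl.
  apply: ler_wpM2r; first by rewrite ler0n.
  have := sqr_ge0 (x n - e * x m); rewrite sqrrB exprMn e2; lra.
under eq_bigr do rewrite big_split/= -mulr_sumr.
rewrite big_split/= [X in _ + X]exchange_big/=.
under [X in _ + X]eq_bigr do rewrite -mulr_sumr.
rewrite -big_split/=; apply: ler_sum => n _.
have h : 0 <= (x n) ^+ 2 / 2 by rewrite mulr_ge0 ?sqr_ge0.
have := ler_wpM2l h (cnt (f n)); have := ler_wpM2l h (cnt2 n); lra.
Qed.

(** The Gram matrix is [b / 2] times the identity plus [e] times the flip [n -> - n], with [e = 1]
    for cosines and [e = -1] for sines. Each of the two pieces has norm at most one, whence the
    constant [b]. *)
Lemma gram_le (s : seq int) (phi : int -> R -> R) (e : R) (x : int -> R) :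
  uniq s -> e ^+ 2 = 1 -> (forall n, sqint D (phi n)) ->
  (forall n m, ip D (phi n) (phi m) = b / 2 * ((m == n)%:R + e * (m == - n)%:R)) ->
  ip D (fun t => \sum_(i <- s) x i * phi i t) (fun t => \sum_(i <- s) x i * phi i t)
    <= b * \sum_(i <- s) (x i) ^+ 2.
Proof.
move=> us e2 sp ipp.
have sxp n : sqint D (fun t => x n * phi n t) by exact: sqintZ.
rewrite ip_sumr//; last exact: sqint_sum.
have e1 n : ip D (fun t => \sum_(i <- s) x i * phi i t) (fun t => x n * phi n t) =
  b / 2 * (\sum_(m <- s) 1 * (x n * x m) * (m == n)%:R +
           \sum_(m <- s) e * (x n * x m) * (m == - n)%:R).
  rewrite ipC ip_sumr; [|exact: measurable_itv|exact: sxp|exact: sxp].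
  rewrite -big_split mulr_sumr/=; apply: eq_bigr => m _.
  rewrite ipZr//; rewrite ipC ipZr// ipC ipp; ring.
under eq_bigr do rewrite e1.
rewrite -mulr_sumr big_split/=.
have := sum_pair_le x us (f := id) (fun _ _ h => h) (expr1n _ 2).
have := sum_pair_le x us (@oppr_inj _) e2.
set A := \sum_(_ <- _) _; set B := \sum_(_ <- _) _; set C := \sum_(_ <- _) _ => h1 h2.
by have := ler_wpM2l (ltW b_gt0) h1; have := ler_wpM2l (ltW b_gt0) h2; lra.
Qed.

Lemma bessel_fourier (s : seq int) (F : R -> R) : uniq s -> sqint D F ->
  \sum_(n <- s) ((ip D F (fun t => cos (freq n * t))) ^+ 2 +
                 (ip D F (fun t => sin (freq n * t))) ^+ 2) <= 2 * b * ip D F F.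
Proof.
move=> us sF; rewrite big_split/= -mulrA mulr_natl mulr2n; apply: lerD.
- apply: bessel => // [i|x]; first exact: sqint_cos.
  apply: (@gram_le s (fun n t => cos (freq n * t)) 1) => //.
  + by rewrite expr1n.
  + by move=> n; exact: sqint_cos.
  + by move=> n m; rewrite ip_cos_cos mul1r.
- apply: bessel => // [i|x]; first exact: sqint_sin.
  apply: (@gram_le s (fun n t => sin (freq n * t)) (-1)) => //.
  + by rewrite sqrrN expr1n.
  + by move=> n; exact: sqint_sin.
  + by move=> n m; rewrite ip_sin_sin mulN1r.
Qed.

End FourierBessel.

(** * Lower Fourier bound for step functions *)

Section Sinc.
Variable R : realType.

(** Write [sin x = 2 sin (x / 2) cos (x / 2)] and, by the mean value theorem,
    [sin (x / 2) = cos c * (x / 2)]. Both cosines are taken on [[0, pi / 4]], so their product is at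
    least [cos (pi / 4) ^ 2 = 1 / 2]. *)
Lemma sin_ge_half (x : R) : 0 <= x -> x <= pi / 2 -> x / 2 <= sin x.
Proof.
move=> x0 xpi; have pi0 := pi_gt0 R.
have x20 : 0 <= x / 2 by rewrite divr_ge0.
have cs : {within `[0, x / 2], continuous (@sin R)}.
  by apply: continuous_subspaceT => z; exact: continuous_sin.
have [c cin] := MVT_segment x20 (fun z _ => is_derive_sin z) cs.
rewrite sin0 !subr0 => sE.
have cos2 : cos (pi / 4 : R) ^+ 2 = 2^-1.
  have := cos_pihalf R; rewrite (_ : pi / 2 = pi / 4 + pi / 4); last by field.
  by rewrite cosD -!expr2 sin2cos2; lra.
have cge (z : R) : 0 <= z -> z <= pi / 4 -> 0 <= cos (pi / 4 : R) <= cos z.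
  move=> z0 z4; rewrite cos_ge0_pihalf/=; last by lra.
  by rewrite leNgt ltr_cos ?in_itv/= -?leNgt//; lra.
have {}cin : 0 <= c <= x / 2 by move: cin; rewrite in_itv.
have /andP[p0 pc] := cge c ltac:(lra) ltac:(lra).
have /andP[_ px] := cge (x / 2) ltac:(lra) ltac:(lra).
have prod : 2^-1 <= cos c * cos (x / 2).
  by rewrite -[leLHS]cos2 expr2; apply: ler_pM.
have -> : sin x = 2 * (sin (x / 2) * cos (x / 2)).
  rewrite {1}(_ : x = x / 2 + x / 2); last by field.
  by rewrite sinD; ring.
rewrite sE.
have := ler_wpM2l x0 prod; lra.
Qed.

(** Multiplied by [2 sin (ph / 2)], the sum telescopes between two values whose arguments differ by
    [2 pi d]. The factor is nonzero because [d] is not a multiple of the number [2 K + 1] of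
    terms. *)
Lemma dirichlet_kernel (K : nat) (d : int) : (0 < `|d| < K.*2.+1)%N ->
  \sum_(i < K.*2.+1) cos (2 * pi * ((i : nat)%:R - K%:R) * d%:~R / (K.*2.+1)%:R) = 0 :> R.
Proof.
set M := K.*2.+1; move=> /andP[d0 dM].
have M0 : (0 : R) < M%:R by rewrite ltr0n.
set ph : R := 2 * pi * d%:~R / M%:R.
have sn0 : sin (ph / 2) != 0.
  have -> : ph / 2 = pi * d%:~R / M%:R by rewrite /ph; field; rewrite gt_eqF.
  have pos (m : nat) : (0 < m < M)%N -> sin (pi * m%:R / M%:R : R) != 0.
    move=> /andP[m0 mM]; rewrite gt_eqF// sin_gt0_pi//; apply/andP; split.
      by rewrite divr_gt0 ?mulr_gt0 ?pi_gt0 ?ltr0n.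
    by rewrite ltr_pdivrMr// ltr_pM2l ?pi_gt0// ltr_nat.
  case: d d0 dM {ph} => m /= d0 dM; first by apply: pos; rewrite d0.
  by rewrite NegzE mulrNz mulrN mulNr sinN oppr_eq0; apply: pos.
apply: (@mulfI _ (2 * sin (ph / 2))); first by rewrite mulf_neq0.
rewrite mulr0 mulr_sumr.
pose g (i : nat) : R := sin ((i%:R - K%:R - 2^-1) * ph).
rewrite (eq_bigr (fun i : 'I_M => g i.+1 - g i)); last first.
  move=> i _; rewrite /g.
  have -> : 2 * pi * ((i : nat)%:R - K%:R) * d%:~R / M%:R = (i%:R - K%:R) * ph.
    by rewrite /ph; ring.
  have -> : (i.+1%:R - K%:R - 2^-1) * ph = (i%:R - K%:R) * ph + ph / 2.
    by rewrite -(addn1 i) natrD; field.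
  have -> : (i%:R - K%:R - 2^-1) * ph = (i%:R - K%:R) * ph - ph / 2 by field.
  by rewrite sinB sinD; ring.
rewrite -(big_mkord xpredT (fun i => g i.+1 - g i)) telescope_sumr//.
rewrite /g.
have -> : (M%:R - K%:R - 2^-1) * ph = (0%:R - K%:R - 2^-1) * ph + 2 * pi * d%:~R.
  have MK : (M%:R : R) = 2 * K%:R + 1 by rewrite /M -addn1 natrD -muln2 natrM mulrC.
  rewrite /ph MK; field; rewrite -MK gt_eqF//.
by rewrite sinD2pin subrr.
Qed.

End Sinc.

Section StepFunctions.
Variables (R : realType) (b al : R) (K : nat).
Hypothesis b_gt0 : 0 < b.
Local Notation mu := (@lebesgue_measure R).
Local Notation D := (`[al, al + b[%classic : set R).
Local Notation M := (K.*2.+1).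

Definition mesh : R := b / M%:R.
Local Notation w := mesh.
Definition cell (j : nat) : set R := `[al + j%:R * w, al + j.+1%:R * w[%classic.
Definition step (v : nat -> R) (t : R) : R := \sum_(j < M) v j * \1_(cell j) t.

Lemma M_gt0 : (0 : R) < M%:R. Proof. by rewrite ltr0n. Qed.
Lemma mesh_gt0 : 0 < w. Proof. by rewrite divr_gt0 ?M_gt0. Qed.
Lemma meshM : M%:R * w = b. Proof. by rewrite mulrC mulfVK ?gt_eqF ?M_gt0. Qed.

Lemma cell_sub j : (j < M)%N -> cell j `<=` D.
Proof.
move=> jM t; rewrite /cell /= !in_itv/= => /andP[h1 h2]; have w0 := mesh_gt0.
have : j.+1%:R * w <= b by rewrite -meshM ler_pM2r// ler_nat.
have : 0 <= j%:R * w by rewrite mulr_ge0 ?ler0n ?ltW.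
lra.
Qed.

Lemma cell_disj i j t : cell i t -> cell j t -> i = j.
Proof.
rewrite /cell /= !in_itv/= => /andP[h1 h2] /andP[h3 h4]; have w0 := mesh_gt0.
have : i%:R * w < j.+1%:R * w by lra.
have : j%:R * w < i.+1%:R * w by lra.
by rewrite !ltr_pM2r// !ltr_nat; lia.
Qed.

Lemma measurable_cell j : measurable (cell j). Proof. exact: measurable_itv. Qed.

Lemma sqint_cell j : sqint D (\1_(cell j) : R -> R).
Proof.
apply: (@sqint_bounded _ _ _ _ 1) => //; first exact: itv_co_fin.
- by apply: measurable_indic; exact: measurable_cell.
- by move=> t _; rewrite indicE; case: (_ \in _); rewrite ?normr1 ?normr0.
Qed.

Lemma sqint_step v : sqint D (step v).
Proof. by apply: sqint_sum => // j; apply: sqintZ => //; exact: sqint_cell. Qed.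

Lemma ip_cell F j : (j < M)%N -> ip D F (\1_(cell j)) = \int[mu]_(t in cell j) F t.
Proof.
move=> jM; rewrite -[in RHS](@setIidl _ (cell j) D); last exact: cell_sub.
rewrite Rintegral_mkcondl; apply: eq_Rintegral => t _.
by rewrite patchE indicE; case: (t \in cell j); rewrite ?mulr1 ?mulr0.
Qed.

Lemma fine_cell j : fine (mu (cell j)) = w.
Proof.
rewrite lebesgue_measure_itv/= lte_fin ltrD2l ltr_pM2r ?mesh_gt0// ltr_nat leqnn.
by rewrite -EFinB/= -addn1 natrD; ring.
Qed.

Lemma ip_cell_cell (i j : 'I_M) : ip D (\1_(cell i)) (\1_(cell j)) = w * (i == j)%:R.
Proof.
rewrite ip_cell//; under eq_Rintegral => t.
  rewrite inE => tj; rewrite (_ : \1_(cell i) t = (i == j)%:R); last first.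
    rewrite indicE; congr (nat_of_bool _)%:R; apply/idP/idP => [|/eqP ->].
      by rewrite inE => ti; apply/eqP/val_inj; exact: (cell_disj ti tj).
    exact/mem_set.
  over.
by rewrite Rintegral_cst; [rewrite fine_cell mulrC|exact: measurable_cell].
Qed.

Lemma ip_step_step v : ip D (step v) (step v) = w * \sum_(j < M) (v j) ^+ 2.
Proof.
have sc j : sqint D (fun t => v j * \1_(cell j) t : R).
  by apply: sqintZ => //; exact: sqint_cell.
rewrite {2}/step ip_sumr//; last exact: sqint_step.
rewrite mulr_sumr; apply: eq_bigr => j _.
rewrite ipZr//; [|exact: sqint_step|exact: sqint_cell].
rewrite ipC /step ip_sumr//; last exact: sqint_cell.
rewrite (bigD1 j)//= big1 ?addr0; last first.
  move=> i ij; rewrite ipZr//; [|exact: sqint_cell|exact: sqint_cell].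
  by rewrite ip_cell_cell eq_sym (negPf ij) mulr0 mulr0.
rewrite ipZr//; [|exact: sqint_cell|exact: sqint_cell].
by rewrite ip_cell_cell eqxx mulr1; ring.
Qed.

Definition mid (j : nat) : R := al + (j%:R + 2^-1) * w.
(* The integral of a step function against the character of index [n] is [sinc n]
   times the discrete Fourier transform of its values. *)
Definition sinc (n : int) : R :=
  if n == 0 then w else 2 * sin (freq b n * w / 2) / freq b n.

Lemma Rintegral_cos_cell n j :
  \int[mu]_(t in cell j) cos (freq b n * t) = sinc n * cos (freq b n * mid j).
Proof.
rewrite /sinc; have [->|n0] := eqVneq n 0.
  under eq_Rintegral do rewrite /freq mulr0z mulr0 !mul0r cos0.
  rewrite Rintegral_cst; last exact: measurable_cell.
  by rewrite fine_cell mul1r /freq mulr0z mulr0 !mul0r cos0 mulr1.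
have f0 : freq b n != 0 by rewrite freq_eq0.
apply: (@mulfI _ (freq b n)) => //.
rewrite Rintegral_cos; last by rewrite lerD2l ler_pM2r ?mesh_gt0// ler_nat.
have -> : freq b n * (al + j.+1%:R * w) = freq b n * mid j + freq b n * w / 2.
  by rewrite /mid -addn1 natrD; field.
have -> : freq b n * (al + j%:R * w) = freq b n * mid j - freq b n * w / 2.
  by rewrite /mid; field.
by rewrite sinB sinD; field.
Qed.

Lemma Rintegral_sin_cell n j :
  \int[mu]_(t in cell j) sin (freq b n * t) = sinc n * sin (freq b n * mid j).
Proof.
rewrite /sinc; have [->|n0] := eqVneq n 0.
  under eq_Rintegral do rewrite /freq mulr0z mulr0 !mul0r sin0.
  rewrite Rintegral_cst; last exact: measurable_cell.
  by rewrite fine_cell mul0r /freq mulr0z mulr0 !mul0r sin0 mulr0.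
have f0 : freq b n != 0 by rewrite freq_eq0.
apply: (@mulfI _ (freq b n)) => //.
rewrite Rintegral_sin; last by rewrite lerD2l ler_pM2r ?mesh_gt0// ler_nat.
have -> : freq b n * (al + j.+1%:R * w) = freq b n * mid j + freq b n * w / 2.
  by rewrite /mid -addn1 natrD; field.
have -> : freq b n * (al + j%:R * w) = freq b n * mid j - freq b n * w / 2.
  by rewrite /mid; field.
by rewrite cosB cosD; field.
Qed.

(** The sine in [sinc] has argument [pi n / (2 K + 1)], which for [|n| <= K] stays within [pi / 2],
    where [sin_ge_half] applies; the zeros of [sinc] lie at the nonzero multiples of [2 K + 1]. *)
Lemma sinc_ge n : (`|n| <= K)%N -> w ^+ 2 / 4 <= (sinc n) ^+ 2.
Proof.
move=> nK; rewrite /sinc; have [_|n0] := eqVneq n 0.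
  by have := sqr_ge0 w; lra.
have f0 : freq b n != 0 by rewrite freq_eq0.
have w0 := mesh_gt0; have M0 := M_gt0.
have E : `|freq b n * w / 2| = pi * (`|n|%N)%:R / M%:R.
  have -> : freq b n * w / 2 = pi * n%:~R / M%:R.
    by rewrite /freq /mesh; field; rewrite !gt_eqF.
  rewrite !normrM normfV (gtr0_norm (pi_gt0 R)) (gtr0_norm M0) -intr_norm.
  by rewrite -abszE.
have := @sin_ge_half R `|freq b n * w / 2| (normr_ge0 _).
have -> : `|freq b n * w / 2| <= pi / 2.
  rewrite E ler_pdivrMr// -mulrA ler_pM2l ?pi_gt0//.
  rewrite mulrC ler_pdivlMr// -natrM ler_nat; lia.
move=> /(_ isT) h.
have sq : (`|freq b n * w / 2| / 2) ^+ 2 <= (sin (freq b n * w / 2)) ^+ 2.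
  have -> : (sin (freq b n * w / 2)) ^+ 2 = (sin `|freq b n * w / 2|) ^+ 2.
    by case: (ger0P (freq b n * w / 2)) => // _; rewrite sinN sqrrN.
  have h0 : 0 <= `|freq b n * w / 2| / 2 by rewrite divr_ge0.
  by rewrite ler_pXn2r ?nnegrE// (le_trans h0 h).
have f2 : 0 < (freq b n) ^+ 2 by rewrite exprn_even_gt0.
move: sq f2; clear; move: mesh (freq b n) => W f sq f2.
rewrite expr_div_n ler_pdivlMr// exprMn.
move: sq; rewrite !expr_div_n real_normK ?num_real// expr_div_n exprMn; lra.
Qed.

(** As many frequencies as cells, so that the discrete transform preserves norms up to scaling, and
    centred at zero to stay in the range of [sinc_ge]. *)
Definition freqs : seq int := [seq (nat_of_ord i)%:Z - K%:Z | i <- index_enum 'I_M].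

Lemma freqs_uniq : uniq freqs.
Proof.
rewrite map_inj_uniq ?index_enum_uniq// => i j.
by move/addIr => [] /val_inj.
Qed.

(** Expanding the squares gives the cosines of [freq n * (mid j - mid l)]. Their sum over the
    frequencies is the Dirichlet kernel at [j - l], which vanishes off the diagonal. *)
Lemma dft_parseval (v : nat -> R) :
  \sum_(n <- freqs) ((\sum_(j < M) v j * cos (freq b n * mid j)) ^+ 2 +
                     (\sum_(j < M) v j * sin (freq b n * mid j)) ^+ 2)
  = M%:R * \sum_(j < M) (v j) ^+ 2.
Proof.
have M0 := M_gt0.
have sqs (x : 'I_M -> R) : (\sum_j x j) ^+ 2 = \sum_j \sum_l x j * x l.
  by rewrite expr2 mulr_suml; apply: eq_bigr => j _; rewrite mulr_sumr.
under eq_bigr => n _.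
  rewrite !sqs -big_split/=.
  under eq_bigr => j _.
    rewrite -big_split/=.
    under eq_bigr => l _.
      rewrite (_ : _ + _ = v j * v l * cos (freq b n * mid j - freq b n * mid l)); last first.
        by rewrite cosB; ring.
      over.
    over.
  over.
rewrite exchange_big/=.
under eq_bigr do rewrite exchange_big/=.
rewrite mulr_sumr; apply: eq_bigr => j _.
have ker (l : 'I_M) : \sum_(n <- freqs) cos (freq b n * mid j - freq b n * mid l) =
    M%:R * (l == j)%:R.
  rewrite big_map.
  have [->|lj] := eqVneq l j.
    under eq_bigr do rewrite subrr cos0.
    by rewrite sumr_const cardT size_enum_ord mulr1.
  rewrite mulr0 -[RHS](@dirichlet_kernel R K ((j : nat)%:Z - (l : nat)%:Z)); last first.
    have := ltn_ord j; have := ltn_ord l; move: lj; rewrite -val_eqE /=; lia.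
  apply: eq_bigr => i _; congr cos.
  rewrite /freq /mid !intrB /mesh; field; rewrite !gt_eqF//.
under eq_bigr do rewrite -mulr_sumr ker.
rewrite (bigD1 j)//= big1 ?addr0 ?eqxx; first by rewrite mulr1; ring.
by move=> l lj; rewrite (negPf lj) !mulr0.
Qed.

(** The constant is independent of [K]: [sinc_ge] contributes [w ^ 2 / 4], Parseval contributes [M],
    the norm of the step function absorbs one [w], and [M * w = b]. *)
Lemma step_lower (v : nat -> R) :
  b / 4 * ip D (step v) (step v) <=
  \sum_(n <- freqs) ((ip D (step v) (fun t => cos (freq b n * t))) ^+ 2 +
                     (ip D (step v) (fun t => sin (freq b n * t))) ^+ 2).
Proof.
have sc j : sqint D (fun t => v j * \1_(cell j) t : R).
  by apply: sqintZ => //; exact: sqint_cell.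
have ec n : ip D (step v) (fun t => cos (freq b n * t)) =
    sinc n * \sum_(j < M) v j * cos (freq b n * mid j).
  rewrite ipC ip_sumr//; last exact: sqint_cos.
  rewrite mulr_sumr; apply: eq_bigr => j _.
  rewrite ipZr//; [|exact: sqint_cos|exact: sqint_cell].
  by rewrite ip_cell// Rintegral_cos_cell; ring.
have es n : ip D (step v) (fun t => sin (freq b n * t)) =
    sinc n * \sum_(j < M) v j * sin (freq b n * mid j).
  rewrite ipC ip_sumr//; last exact: sqint_sin.
  rewrite mulr_sumr; apply: eq_bigr => j _.
  rewrite ipZr//; [|exact: sqint_sin|exact: sqint_cell].
  by rewrite ip_cell// Rintegral_sin_cell; ring.
under eq_bigr do rewrite ec es !exprMn -mulrDr.
apply: (@le_trans _ _ (w ^+ 2 / 4 * (M%:R * \sum_(j < M) (v j) ^+ 2))).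
  rewrite ip_step_step -[X in X / 4 * _]meshM.
  by rewrite le_eqVlt; apply/orP; left; apply/eqP; field.
rewrite -dft_parseval mulr_sumr big_seq [leRHS]big_seq; apply: ler_sum => n.
move=> /mapP[i _ ->]; apply: ler_wpM2r; first by rewrite addr_ge0 ?sqr_ge0.
by apply: sinc_ge; have := ltn_ord i; lia.
Qed.

End StepFunctions.

(** * Density of step functions on a period *)

Section L2Approximation.
Variable R : realType.
Local Notation mu := (@lebesgue_measure R).
Variable D : set R.
Hypothesis mD : measurable D.

Lemma ip_le (F G H : R -> R) (r s : R) : sqint D F -> sqint D G -> sqint D H ->
  (forall x, D x -> (F x) ^+ 2 <= r * (G x) ^+ 2 + s * (H x) ^+ 2) ->
  ip D F F <= r * ip D G G + s * ip D H H.
Proof.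
move=> sF sG sH FGH; have iF := mul_integrable mD sF sF.
have iG := mul_integrable mD sG (sqintZ mD r sG).
have iH := mul_integrable mD sH (sqintZ mD s sH).
rewrite -!ipZr// /ip -RintegralD//.
apply: le_Rintegral => //.
  exact: (@integrableD _ (measurableTypeR R) R mu D mD _ _ iG iH).
by move=> x Dx; have := FGH x Dx; lra.
Qed.

Lemma ip_triangle (F G H : R -> R) : sqint D F -> sqint D G -> sqint D H ->
  ip D (fun x => F x - H x) (fun x => F x - H x) <=
  2 * ip D (fun x => F x - G x) (fun x => F x - G x) +
  2 * ip D (fun x => G x - H x) (fun x => G x - H x).
Proof.
move=> sF sG sH; apply: ip_le; [exact: sqintB|exact: sqintB|exact: sqintB|].
by move=> x _; have := sqr_ge0 (F x - 2 * G x + H x); lra.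
Qed.

Lemma dominated_ip_cvg0 (f : nat -> R -> R) (g : R -> R) :
  (forall n, measurable_fun D (f n)) -> sqint D g ->
  (forall n x, D x -> `|f n x| <= `|g x|) ->
  (forall x, D x -> f n x @[n --> \oo] --> (0 : R)) ->
  forall eta, 0 < eta -> exists n, ip D (f n) (f n) < eta.
Proof.
move=> mf sg fg f0 eta eta0.
have sf n : sqint D (f n).
  apply: (sqint_le mD (mf n) sg sg) => x Dx.
  rewrite -[leLHS]real_normK ?num_real// -[X in X + _]real_normK ?num_real//.
  have h := fg n x Dx; have : `|f n x| ^+ 2 <= `|g x| ^+ 2 by rewrite lerXn2r ?nnegrE.
  by have := sqr_ge0 (g x); lra.
have c0 x : D x -> ((f n x) ^+ 2)%:E @[n --> \oo] --> (0%R)%:E.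
  move=> Dx; apply: cvg_EFin; first by near=> n.
  by rewrite -(mulr0 (0 : R)); apply: cvgM; exact: f0.
have dom x n : D x -> (`|((f n x) ^+ 2)%:E| <= ((g x) ^+ 2)%:E)%E.
  move=> Dx; rewrite gee0_abs ?lee_fin ?sqr_ge0//.
  rewrite -[leLHS]real_normK ?num_real// -[leRHS]real_normK ?num_real//.
  by rewrite lerXn2r ?nnegrE ?fg.
have mc : measurable_fun D (fun=> 0 : \bar R)%E by exact: measurable_cst.
have ae1 : {ae mu, forall x, D x -> ((f n x) ^+ 2)%:E @[n --> \oo] --> (0%R)%:E}.
  by apply: aeW => x; exact: c0.
have ae2 : {ae mu, forall x n, D x -> (`|((f n x) ^+ 2)%:E| <= ((g x) ^+ 2)%:E)%E}.
  by apply: aeW => x n; exact: dom.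
have [_ _] := @dominated_convergence _ (measurableTypeR R) R mu D mD
  (fun n x => ((f n x) ^+ 2)%:E) (fun=> 0%E) (fun x => ((g x) ^+ 2)%:E)
  (fun n => measurable_sqr (mf n)) mc ae1
  (sqr_integrable sg) ae2.
rewrite integral0 => /fine_fcvg /cvgr0_norm_lt /(_ _ eta0) [N _ /(_ N (leqnn N))] /=.
rewrite -ipE//= ger0_norm ?ip_ge0// => h.
by exists N.
Unshelve. all: by end_near.
Qed.

End L2Approximation.

Section Clip.
Variable R : realType.

Definition clip (k x : R) : R := Num.max (- k) (Num.min k x).

Lemma clip_norm k x : 0 <= k -> `|clip k x| <= k.
Proof.
move=> k0; rewrite /clip ler_norml /Num.max /Num.min.
by repeat case: ifPn; rewrite -?leNgt => *; apply/andP; split; lra.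
Qed.

Lemma clip_id k x : `|x| <= k -> clip k x = x.
Proof.
rewrite ler_norml => /andP[h1 h2]; rewrite /clip /Num.max /Num.min.
by repeat case: ifPn; rewrite -?leNgt => *; lra.
Qed.

Lemma clip_lip k x y : 0 <= k -> `|clip k x - clip k y| <= `|x - y|.
Proof.
move=> k0; have := ler_norm (x - y); have := ler_norm (y - x).
rewrite (distrC y x) => h1 h2; rewrite ler_norml /clip /Num.max /Num.min.
by repeat case: ifPn; rewrite -?leNgt => *; apply/andP; split; lra.
Qed.

Lemma clip0 k : 0 <= k -> clip k 0 = 0.
Proof. by move=> k0; apply: clip_id; rewrite normr0. Qed.

Lemma continuous_clip k : 0 <= k -> continuous (clip k).
Proof.
move=> k0 x; apply/cvgrPdist_lt => e e0; near=> y.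
by rewrite (le_lt_trans (clip_lip _ _ k0))//; near: y; exact: (@cvgr_dist_lt _ _ _ _ _ id).
Unshelve. all: by end_near. Qed.

Lemma measurable_clip D k (F : R -> R) : 0 <= k -> measurable_fun D F ->
  measurable_fun D (fun x => clip k (F x)).
Proof.
move=> k0 mF; apply: (measurableT_comp (f := clip k)) => //.
by apply: continuous_measurable_fun; exact: continuous_clip.
Qed.

End Clip.

Section StepDensity.
Variables (R : realType) (b al : R).
Hypothesis b_gt0 : 0 < b.
Local Notation mu := (@lebesgue_measure R).
Local Notation D := (`[al, al + b[%classic : set R).

Lemma clip_approx (F : R -> R) (eta : R) : sqint D F -> 0 < eta ->
  exists2 k : R, 0 <= k &
    ip D (fun x => F x - clip k (F x)) (fun x => F x - clip k (F x)) < eta.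
Proof.
move=> sF eta0; have [mF _] := sF.
have h1 (n : nat) : measurable_fun D (fun x => F x - clip n%:R (F x)).
  by apply: measurable_funB => //; apply: measurable_clip.
have h2 (n : nat) x : D x -> `|F x - clip n%:R (F x)| <= `|F x|.
  move=> Dx; have := clip_lip (F x) 0 (ler0n R n); rewrite clip0// !subr0.
  rewrite /clip /Num.max /Num.min; have := ler0n R n.
  case: (ger0P (F x)) => Fx; rewrite !ler_norml;
  by repeat case: ifPn; rewrite -?leNgt => *; apply/andP; split; lra.
have h3 x : D x -> F x - clip n%:R (F x) @[n --> \oo] --> (0 : R).
  move=> Dx; apply: cvg_near_cst; near=> n; rewrite clip_id ?subrr//.
  by near: n; exact: nbhs_infty_ger.
have [n hn] := dominated_ip_cvg0 (measurable_itv _) h1 sF h2 h3 eta0.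
by exists n%:R.
Unshelve. all: by end_near. Qed.

(** Boundedness turns an approximation in the mean into one in mean square, through
    [(F - h) ^ 2 <= 2 k |F - h|]. Clipping the approximant makes it bounded by [k] and does not
    increase the error, because [clip k] is 1-Lipschitz and fixes the values of [F]. *)
Lemma continuous_approx (F : R -> R) (k eta : R) : 0 <= k -> measurable_fun D F ->
  (forall x, `|F x| <= k) -> 0 < eta ->
  exists h : R -> R, [/\ continuous h, (forall x, `|h x| <= k) &
    ip D (fun x => F x - h x) (fun x => F x - h x) < eta].
Proof.
move=> k0 mF Fk eta0.
have sF : sqint D F by apply: (@sqint_bounded _ _ _ _ k) => //; exact: itv_co_fin.
have iF : mu.-integrable D (EFin \o F).
  have := mul_integrable (measurable_itv _) (sqint_cst al (al + b) 1) sF.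
  by apply: eq_integrable => // t _ /=; rewrite mul1r.
have [g_ [cg ig]] := approximation_continuous_integrable (measurable_itv _) (itv_co_fin _ _) iF.
(* The summand 1 keeps the denominator positive when [k = 0]. *)
have e0 : 0 < eta / (2 * k + 1) by rewrite divr_gt0//; lra.
move=> /fine_fcvg /cvgr0_norm_lt /(_ _ e0) [n _ /(_ n (leqnn n))] /= gn.
exists (fun x => clip k (g_ n x)); split.
- by move=> x; apply: continuous_comp; [exact: cg|exact: continuous_clip].
- by move=> x; exact: clip_norm.
have mg : measurable_fun D (g_ n).
  by apply: measurable_funTS; apply: continuous_measurable_fun; exact: cg.
have mFg : measurable_fun D (fun x => `|(F x - g_ n x)%:E|)%E.
  by apply: measurableT_comp => //; apply/measurable_EFinP; exact: measurable_funB.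
have sd : sqint D (fun x => F x - clip k (g_ n x)).
  apply: sqintB => //; apply: (@sqint_bounded _ _ _ _ k) => //; first exact: itv_co_fin.
    exact: measurable_clip.
  by move=> x _; exact: clip_norm.
have fin : (\int[mu]_(x in D) `|(F x - g_ n x)%:E|)%E \is a fin_num.
  apply: integrable_fin_num => //; apply: integrable_abse.
  exact: (@integrableB _ (measurableTypeR R) R mu D (measurable_itv _) _ _ iF (ig n)).
rewrite -lte_fin ipE//.
apply: (@le_lt_trans _ _ ((2 * k)%:E * \int[mu]_(x in D) `|(F x - g_ n x)%:E|)%E).
  rewrite -ge0_integralZl//; last by rewrite lee_fin mulr_ge0.
  apply: ge0_le_integral => //.
  + by move=> x _; rewrite lee_fin sqr_ge0.
  + by apply: measurable_sqr; have [] := sd.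
  + by apply: emeasurable_funM => //; exact: measurable_cst.
  + move=> x _ /=; rewrite -EFinM lee_fin -[leLHS]real_normK ?num_real// expr2.
    apply: ler_pM => //.
      rewrite (le_trans (ler_normB _ _))//.
      by have := Fk x; have := clip_norm (g_ n x) k0; lra.
    by rewrite -{1}(clip_id (Fk x)); exact: clip_lip.
rewrite -(fineK fin) -EFinM lte_fin.
move: gn; rewrite ltr_norml => /andP[_].
rewrite ltr_pdivlMr; last by lra.
have : 0 <= fine (\int[mu]_(x in D) `|(F x - g_ n x)%:E|).
  by apply: fine_ge0; apply: integral_ge0.
lra.
Qed.

Lemma stepE K (v : nat -> R) t : D t -> exists j : nat,
  [/\ (j < K.*2.+1)%N, cell b al K j t & step b al K v t = v j].
Proof.
rewrite /= in_itv/= => /andP[t1 t2].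
have w0 := mesh_gt0 K b_gt0; have wM := meshM b K; set w := mesh b K in w0 wM *.
have x0 : 0 <= (t - al) / w by rewrite divr_ge0 ?subr_ge0// ltW.
pose j := Num.truncn ((t - al) / w).
have /andP[j1 j2] := truncn_itv x0; rewrite -/j in j1 j2.
have tj : cell b al K j t.
  rewrite /cell /= in_itv/= -/w; move: j1 j2.
  by rewrite ler_pdivlMr// ltr_pdivrMr// => *; apply/andP; split; lra.
have jM : (j < K.*2.+1)%N.
  rewrite -(ltr_nat R) -(ltr_pM2r w0) wM; move: j1; rewrite ler_pdivlMr//; lra.
exists j; split => //; rewrite /step (bigD1 (Ordinal jM))//= big1 ?addr0.
  by rewrite indicE mem_set ?mulr1.
move=> i ij; rewrite indicE memNset ?mulr0// => ti.
by move/negP: ij; apply; apply/eqP/val_inj; exact: (cell_disj b_gt0 ti tj).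
Qed.

(** Sampling [h] at the left ends of the cells converges pointwise by continuity, and the error is
    dominated by the constant [2 k]. *)
Lemma step_approx_continuous (h : R -> R) (k eta : R) : continuous h ->
  (forall x, `|h x| <= k) -> 0 < eta -> exists K (v : nat -> R),
    ip D (fun x => h x - step b al K v x) (fun x => h x - step b al K v x) < eta.
Proof.
move=> ch hk eta0.
pose v K (j : nat) := h (al + j%:R * mesh b K).
have h1 n : measurable_fun D (fun x => h x - step b al n (v n) x).
  apply: measurable_funB; last by have [] := sqint_step b al n (v n).
  by apply: measurable_funTS; apply: continuous_measurable_fun; exact: ch.
have h2 n x : D x -> `|h x - step b al n (v n) x| <= `|k + k|.
  move=> Dx; have [j [_ _ ->]] := stepE n (v n) Dx.
  rewrite (le_trans (ler_normB _ _))// (le_trans _ (ler_norm _))//.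
  by apply: lerD; exact: hk.
have h3 x : D x -> h x - step b al n (v n) x @[n --> \oo] --> (0 : R).
  move=> Dx; apply/cvgrPdist_lt => e e0.
  have /cvgrPdist_lt /(_ _ e0) /nbhs_ballP[d /= d0 hd] := ch x.
  near=> n; rewrite sub0r normrN; have [j [_ xj ->]] := stepE n (v n) Dx.
  apply: hd; rewrite /ball /=; move: xj; rewrite /cell /= in_itv/= => /andP[x1 x2].
  have wd : mesh b n < d.
    rewrite /mesh ltr_pdivrMr ?ltr0n//.
    have : b / d < n%:R by near: n; exact: nbhs_infty_gtr.
    rewrite ltr_pdivrMr// => h4; apply: (lt_le_trans h4).
    by rewrite mulrC ler_pM2l// ler_nat; lia.
  have : j.+1%:R * mesh b n = j%:R * mesh b n + mesh b n by rewrite -addn1 natrD; ring.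
  by move=> e1; rewrite ltr_norml; apply/andP; split; lra.
have [n hn] := dominated_ip_cvg0 (measurable_itv _) h1 (sqint_cst _ _ (k + k)) h2 h3 eta0.
by exists n, (v n).
Unshelve. all: by end_near. Qed.

End StepDensity.

(** * Two-sided bounds for Fourier coefficients *)

Section FourierBounds.
Variables (R : realType) (b al : R).
Hypothesis b_gt0 : 0 < b.
Local Notation mu := (@lebesgue_measure R).
Local Notation D := (`[al, al + b[%classic : set R).

Lemma step_dense (F : R -> R) (eta : R) : sqint D F -> 0 < eta ->
  exists K (v : nat -> R),
    ip D (fun x => F x - step b al K v x) (fun x => F x - step b al K v x) < eta.
Proof.
(* The three errors enter with weights 2, 4 and 4 after two uses of [ip_triangle], a total of 10,
   below 16. *)
move=> sF eta0; have e0 : 0 < eta / 16 by lra.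
have [k k0 hk] := clip_approx sF e0.
have [mF _] := sF.
have mc : measurable_fun D (fun x => clip k (F x)) by exact: measurable_clip.
have [h [ch hb hh]] := continuous_approx k0 mc (fun x => clip_norm (F x) k0) e0.
have [K [v hv]] := step_approx_continuous al b_gt0 ch hb e0.
exists K, v.
have sc : sqint D (fun x => clip k (F x)).
  apply: (@sqint_bounded _ _ _ _ k) => //; first exact: itv_co_fin.
  by move=> x _; exact: clip_norm.
have sh : sqint D h.
  apply: (@sqint_bounded _ _ _ _ k) => //; first exact: itv_co_fin.
  by apply: measurable_funTS; apply: continuous_measurable_fun; exact: ch.
have ss := sqint_step b al K v.
have := ip_triangle (measurable_itv _) sF sc ss.
have := ip_triangle (measurable_itv _) sc sh ss.
lra.
Qed.

Definition coef2 (F : R -> R) (n : int) : R :=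
  (ip D F (fun t => cos (freq b n * t))) ^+ 2 +
  (ip D F (fun t => sin (freq b n * t))) ^+ 2.

Lemma coef2_ge0 F n : 0 <= coef2 F n.
Proof. by rewrite addr_ge0 ?sqr_ge0. Qed.

Lemma coef2_le F G n : sqint D F -> sqint D G ->
  coef2 G n <= 2 * coef2 F n + 2 * coef2 (fun x => F x - G x) n.
Proof.
move=> sF sG; rewrite /coef2.
have lin (phi : R -> R) : sqint D phi ->
    ip D (fun x => F x - G x) phi = ip D F phi - ip D G phi.
  move=> sp; rewrite ipC (_ : (fun x => F x - G x) = (fun x => F x + (-1) * G x)).
    rewrite ipDr//; last exact: sqintZ.
    by rewrite ipZr// !(ipC D phi) mulN1r.
  by apply/funext => x; rewrite mulN1r.
rewrite !lin; [|exact: sqint_sin|exact: sqint_cos].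
set x := ip D F _; set y := ip D G _; set z := ip D F _; set u := ip D G _.
by have := sqr_ge0 (2 * x - y); have := sqr_ge0 (2 * z - u); lra.
Qed.

(** The constant [b / 4] of [step_lower] is halved twice: once to pass from the norm of [F] to that
    of the step function, once to pass back from the coefficients of the step function to those of
    [F]. The coefficients of the remainder are controlled by [bessel_fourier]. *)
Lemma fourier_lower_approx (F : R -> R) (eta : R) : sqint D F -> 0 < eta ->
  exists2 s : seq int, uniq s & b / 16 * ip D F F <= \sum_(n <- s) coef2 F n + eta.
Proof.
move=> sF eta0; have e0 : 0 < eta / (4 * b) by rewrite divr_gt0 ?mulr_gt0.
have [K [v hv]] := step_dense sF e0.
exists (freqs K); first exact: freqs_uniq.
have ss := sqint_step b al K v.
have lo := step_lower al K b_gt0 v.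
have sd := sqintB (measurable_itv _) sF ss.
have up := bessel_fourier b_gt0 (freqs_uniq K) sd.
have : \sum_(n <- freqs K) coef2 (step b al K v) n <=
    2 * \sum_(n <- freqs K) coef2 F n +
    2 * \sum_(n <- freqs K) coef2 (fun x => F x - step b al K v x) n.
  rewrite !mulr_sumr -big_split/=; apply: ler_sum => n _; exact: coef2_le.
have : ip D F F <= 2 * ip D (step b al K v) (step b al K v) +
     2 * ip D (fun x => F x - step b al K v x) (fun x => F x - step b al K v x).
  apply: ip_le => // x _.
  by have := sqr_ge0 (F x - 2 * step b al K v x); lra.
move: hv up lo; rewrite ltr_pdivlMr ?mulr_gt0//.
set P := ip D F F; set Q := ip D _ _; set S := ip D _ _.
rewrite -/(coef2 _ _); set A := \sum_(n <- _) _; set B := \sum_(n <- _) _.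
set C := \sum_(n <- freqs K) coef2 F n.
move=> hv up lo h1 h2.
have := ler_wpM2l (ltW b_gt0) h1; lra.
Qed.

Lemma fourier_lower (F : R -> R) : sqint D F ->
  ((b / 16)%:E * \int[mu]_(x in D) ((F x) ^+ 2)%:E <=
   \esum_(n in [set: int]) (coef2 F n)%:E)%E.
Proof.
move=> sF; rewrite -ipE//; apply/lee_addgt0Pr => e e0.
have [s us hs] := fourier_lower_approx sF e0.
rewrite -EFinM; apply: (@le_trans _ _ ((\sum_(n <- s) coef2 F n)%:E + e%:E)%E).
  by rewrite -EFinD lee_fin.
rewrite leeD2r//; apply: esum_ge; exists [set` s]; first by split => //; exact: finite_seq.
by rewrite -sumEFin (fsbig_seq _ _ us).
Qed.

Lemma fourier_upper (F : R -> R) : sqint D F ->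
  (\esum_(n in [set: int]) (coef2 F n)%:E <=
   (2 * b)%:E * \int[mu]_(x in D) ((F x) ^+ 2)%:E)%E.
Proof.
move=> sF; rewrite -ipE//; apply: ge_ereal_sup => _ [X [fX _] <-].
rewrite fsbig_finite// sumEFin -EFinM lee_fin.
by apply: bessel_fourier => //; exact: finmap.fset_uniq.
Qed.

End FourierBounds.

(** An enumeration of the integers by parity; it turns sums over [int] into series over [nat], which
    can be exchanged with integrals over countable unions and with scalar factors. *)
Definition int_of_nat (n : nat) : int := if odd n then Negz n./2 else Posz n./2.

Lemma int_of_nat_bij : set_bij [set: nat] [set: int] int_of_nat.
Proof.
split => // [n m _ _|z _].
  by rewrite /int_of_nat; case: ifP => h1; case: ifP => h2 [] h3; lia.
case: z => n.
  by exists n.*2 => //; rewrite /int_of_nat odd_double doubleK.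
by exists n.*2.+1 => //; rewrite /int_of_nat /= odd_double /= uphalf_double.
Qed.

(** * The frame criterion *)

Section Tiling.
Variables (R : realType) (a : R).
Hypothesis a_gt0 : 0 < a.
Local Notation mu := (@lebesgue_measure R).

Definition tile (m : int) : set R := `[m%:~R * a, (m + 1)%:~R * a[%classic.

Lemma measurable_tile m : measurable (tile m). Proof. exact: measurable_itv. Qed.

Lemma tile_floor t : tile (Num.floor (t / a)) t.
Proof.
rewrite /tile /= in_itv/=; have /andP[h1 h2] := floor_itv (t / a).
by rewrite -ler_pdivlMr// h1 -ltr_pdivrMr.
Qed.

Lemma tile_inj m m' t : tile m t -> tile m' t -> m = m'.
Proof.
rewrite /tile /= !in_itv/= => /andP[h1 h2] /andP[h3 h4].
have := le_lt_trans h1 h4; have := le_lt_trans h3 h2.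
by rewrite !ltr_pM2r// !ltr_int; lia.
Qed.

Lemma bigcup_tile : \bigcup_n tile (int_of_nat n) = [set: R].
Proof.
apply/seteqP; split => // t _.
have [_ _ /(_ (Num.floor (t / a)) I) [n _ en]] := int_of_nat_bij.
by exists n => //; rewrite en; exact: tile_floor.
Qed.

Lemma integral_tile (h : R -> \bar R) : measurable_fun setT h ->
  (forall x, 0 <= h x)%E ->
  (\esum_(m in [set: int]) \int[mu]_(x in tile m) h x = \int[mu]_x h x)%E.
Proof.
move=> mh h0.
rewrite (reindex_esum [set: nat] [set: int] int_of_nat); last exact: int_of_nat_bij.
rewrite -nneseries_esumT; last by move=> n; exact: integral_ge0.
rewrite -(@ge0_integral_bigcup _ (measurableTypeR R) R mu (fun n => tile (int_of_nat n)))//.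
- by rewrite bigcup_tile.
- by move=> n; exact: measurable_tile.
- by rewrite bigcup_tile.
- apply/trivIsetP => i j _ _ ij; apply/seteqP; split => // t [ti tj].
  have [_ inj _] := int_of_nat_bij.
  by move/eqP: ij; apply; apply: inj; rewrite ?inE//; exact: tile_inj ti tj.
Qed.

Lemma measurable_fun_tile (d : measure_display) (T : measurableType d) (f : R -> T) :
  (forall m, measurable_fun (tile m) f) -> measurable_fun setT f.
Proof.
move=> mf; rewrite -bigcup_tile; apply/measurable_fun_bigcup => n; [exact: measurable_tile|exact: mf].
Qed.

Lemma esum_shift_int (f : int -> \bar R) (i : int) :
  (\esum_(m in [set: int]) f (m + i)%R = \esum_(m in [set: int]) f m)%E.
Proof.
rewrite -(reindex_esum [set: int] [set: int] (fun m => m + i)%R)//; split => //.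
  by move=> x y _ _ /addIr.
by move=> x _; exists (x - i) => //; rewrite subrK.
Qed.

Lemma sume_cst (x : \bar R) (Q : nat) : (0 <= x)%E ->
  (\sum_(i < Q) x = Q%:R%:E * x)%E.
Proof.
move=> x0; elim: Q => [|Q ih]; first by rewrite big_ord0 mul0e.
by rewrite big_ord_recr/= ih -{2}(mul1e x) -ge0_muleDl ?lee_fin// -EFinD natr1.
Qed.

Lemma integral_itv_tiles (h : R -> \bar R) (m : int) (Q : nat) :
  measurable_fun setT h -> (forall x, 0 <= h x)%E ->
  (\int[mu]_(x in `[(m%:~R * a)%R, ((m + Q%:Z)%:~R * a)%R[) h x =
   \sum_(i < Q) \int[mu]_(x in tile (m + (i : nat)%:Z)%R) h x)%E.
Proof.
move=> mh h0; elim: Q => [|Q ih].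
  by rewrite big_ord0 addr0 set_itvco0 integral_set0.
rewrite big_ord_recr/= -ih.
have e : m + Q.+1%:Z = m + Q%:Z + 1 by lia.
have -> : `[m%:~R * a, (m + Q.+1%:Z)%:~R * a[%classic =
    `[m%:~R * a, (m + Q%:Z)%:~R * a[%classic `|` tile (m + Q%:Z).
  rewrite /tile -itv_bndbnd_setU ?bnd_simp ?e//; rewrite ler_pM2r// ler_int; lia.
apply: ge0_integral_setU => //.
- exact: measurable_tile.
- by apply: measurable_funTS.
- apply/disj_setPS => t []; rewrite /tile /= !in_itv/= => /andP[_ h1] /andP[h2 _].
  by move: (lt_le_trans h1 h2); rewrite ltxx.
Qed.

(** Each interval is covered by the [Q] tiles that start at its left end. When [m] varies, each of
    the [Q] shifted families of tiles covers the line once. *)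
Lemma esum_overlap_le (h : R -> \bar R) (b : R) (Q : nat) : b <= Q%:R * a ->
  measurable_fun setT h -> (forall x, 0 <= h x)%E ->
  (\esum_(m in [set: int]) \int[mu]_(x in `[(m%:~R * a)%R, (m%:~R * a + b)%R[) h x <=
   Q%:R%:E * \int[mu]_x h x)%E.
Proof.
move=> bQ mh h0.
apply: (@le_trans _ _ (\esum_(m in [set: int])
    \sum_(i < Q) \int[mu]_(x in tile (m + (i : nat)%:Z)%R) h x)%E).
  apply: le_esum => m _; rewrite -integral_itv_tiles//.
  apply: ge0_subset_integral => //; first exact: measurable_funTS.
  move=> t /=; rewrite !in_itv/= => /andP[-> h2]/=; apply: (lt_le_trans h2).
  by rewrite intrD mulrDl lerD2l.
rewrite esum_sum; last by move=> *; exact: integral_ge0.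
under eq_bigr do rewrite (esum_shift_int (fun m => \int[mu]_(x in tile m) h x)%E).
by rewrite integral_tile// sume_cst// integral_ge0.
Qed.

End Tiling.

(** * Periodization over the windows *)

Section Periodization.
Variables (R : realType) (a b c : R) (K : nat).
Hypotheses (a_gt0 : 0 < a) (b_gt0 : 0 < b) (c_le : c <= K%:R * b).
Local Notation mu := (@lebesgue_measure R).

Definition window (m : int) : set R := `[m%:~R * a, m%:~R * a + b[%classic.

(* Meant for [t] in [window m] only: points of [t + b Z] to the left of [t] are not
   summed. *)
Definition periodize (u : R -> R) (m : int) (t : R) : R :=
  \sum_(j < K) u (t + j%:R * b) * chi0c c (t + j%:R * b - m%:~R * a).

Definition energy (u : R -> R) (m : int) : \bar R :=
  (\int[mu]_(t in window m) ((periodize u m t) ^+ 2)%:E)%E.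

Lemma sqintS (D E : set R) (F : R -> R) : measurable D -> measurable E ->
  D `<=` E -> sqint E F -> sqint D F.
Proof.
move=> mD mE DE [mF iF]; have mF' : measurable_fun D F by exact: measurable_funS mF.
split=> //; apply: le_lt_trans iF; apply: ge0_subset_integral => //.
  exact: measurable_sqr.
by move=> x _; rewrite lee_fin sqr_ge0.
Qed.

Lemma sqint_shift (u : R -> R) (s : R) : sqint setT u -> sqint setT (fun t => u (t + s)).
Proof.
move=> [mu_ iu]; have ms : measurable_fun setT (fun t : R => u (t + s)).
  by apply: measurableT_comp => //; exact: measurable_shift.
split=> //; rewrite (@ge0_integral_shift R s setT (fun x => ((u x) ^+ 2)%:E)) in iu => //.
  exact: measurable_sqr.
by move=> x _; rewrite lee_fin sqr_ge0.
Qed.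

Lemma measurable_chi0c (r : R) : measurable_fun setT (chi0c r : R -> R).
Proof.
rewrite (_ : chi0c r = \1_(`[0, r[%classic)); first exact: measurable_indic.
apply/funext => t; rewrite indicE /chi0c.
have -> : (t \in `[0, r[%classic) = ((0 <= t) && (t < r)).
  by apply/idP/idP; rewrite inE /= in_itv.
by case: ifP.
Qed.

Lemma sqint_window (u : R -> R) (s : R) : sqint setT u ->
  sqint setT (fun t => u t * chi0c c (t - s)).
Proof.
move=> su; have [mu_ _] := su; apply: (sqint_le _ _ su (sqint0 _)) => //.
  apply: measurable_funM => //; apply: measurableT_comp; first exact: measurable_chi0c.
  exact: measurable_shift.
by move=> x _; rewrite /chi0c; case: ifP => _; rewrite ?mulr1 ?mulr0 expr0n/= ?addr0 ?sqr_ge0.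
Qed.

Lemma sqint_per u m D : measurable D -> sqint setT u -> sqint D (periodize u m).
Proof.
move=> mD su; apply: (@sqintS _ setT) => //; apply: sqint_sum => // j.
exact: (@sqint_shift (fun t => u t * chi0c c (t - m%:~R * a)) _ (sqint_window _ su)).
Qed.

Lemma Rintegral_shift (f : R -> R) (x y s : R) :
  measurable_fun `[x + s, y + s[ f ->
  \int[mu]_(t in `[x + s, y + s[) f t = \int[mu]_(t in `[x, y[) f (t + s).
Proof.
move=> mf; rewrite /Rintegral (@integral_shift R s _ (fun t => (f t)%:E))//; last first.
  exact/measurable_EFinP.
congr (fine (integral _ _ _)); apply/seteqP; split => t /=; rewrite !in_itv/=; lra.
Qed.

Lemma Rintegral_split (f : R -> R) (al : R) (n : nat) :
  mu.-integrable `[al, al + n%:R * b[ (EFin \o f) ->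
  \int[mu]_(t in `[al, al + n%:R * b[) f t =
  \sum_(j < n) \int[mu]_(t in `[al, al + b[) f (t + j%:R * b).
Proof.
elim: n => [|n ih] intf.
  by rewrite big_ord0 mul0r addr0 set_itvco0 Rintegral_set0.
have nb : n.+1%:R * b = n%:R * b + b by rewrite -addn1 natrD; ring.
have nb0 : 0 <= n%:R * b by rewrite mulr_ge0 ?ler0n ?ltW.
have e : `[al, al + n.+1%:R * b[%classic =
    `[al, al + n%:R * b[%classic `|` `[al + n%:R * b, (al + b) + n%:R * b[%classic.
  have -> : al + b + n%:R * b = al + n.+1%:R * b by rewrite nb; ring.
  have h1 : al <= al + n%:R * b by rewrite lerDl.
  have h2 : al + n%:R * b <= al + n.+1%:R * b by rewrite lerD2l nb lerDl ltW.
  by rewrite -itv_bndbnd_setU ?bnd_simp.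
have i1 : mu.-integrable `[al, al + n%:R * b[ (EFin \o f).
  by apply: integrableS intf => //; rewrite e; exact: subsetUl.
have i2 : mu.-integrable `[al + n%:R * b, (al + b) + n%:R * b[ (EFin \o f).
  by apply: integrableS intf => //; rewrite e; exact: subsetUr.
rewrite big_ord_recr/= -ih// -Rintegral_shift; last first.
  by apply/measurable_EFinP; exact: measurable_int i2.
rewrite e in intf *; rewrite Rintegral_setU//.
apply/disj_setPS => t [] /=; rewrite !in_itv/= => /andP[_ h1] /andP[h2 _].
by move: (lt_le_trans h1 h2); rewrite ltxx.
Qed.


Lemma cos_freq_shift n (j : nat) t : cos (freq b n * (t + j%:R * b)) = cos (freq b n * t).
Proof.
have -> : freq b n * (t + j%:R * b) = freq b n * t + 2 * pi * (n * j%:Z)%:~R.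
  by rewrite intrM mulrA -(freqb b_gt0); ring.
exact: cosD2pin.
Qed.

Lemma sin_freq_shift n (j : nat) t : sin (freq b n * (t + j%:R * b)) = sin (freq b n * t).
Proof.
have -> : freq b n * (t + j%:R * b) = freq b n * t + 2 * pi * (n * j%:Z)%:~R.
  by rewrite intrM mulrA -(freqb b_gt0); ring.
exact: sinD2pin.
Qed.

(** Because [c <= K * b], the translated indicator vanishes outside [[m a, m a + K b)]. Cut this
    interval into [K] periods and use the periodicity of [phi]. *)
Lemma window_ip (u phi : R -> R) m : sqint setT u ->
  (forall x y, sqint `[x, y[ phi) -> (forall (j : nat) t, phi (t + j%:R * b) = phi t) ->
  mu.-integrable setT (EFin \o (fun t => u t * chi0c c (t - m%:~R * a) * phi t)) /\
  \int[mu]_t (u t * chi0c c (t - m%:~R * a) * phi t) = ip (window m) (periodize u m) phi.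
Proof.
move=> su sp pp; pose F t := u t * chi0c c (t - m%:~R * a).
set al := m%:~R * a; pose D := `[al, al + K%:R * b[%classic : set R.
have sF : sqint setT F by exact: sqint_window.
have F0 t : ~ D t -> F t = 0.
  move=> nD; rewrite /F /chi0c -/al; case: ifP; rewrite ?mulr0// => /andP[h1 h2].
  exfalso; apply: nD; rewrite /D /= in_itv/= -subr_ge0 h1/=.
  by rewrite -ltrBlDl (lt_le_trans h2).
have sFS x y : sqint `[x, y[ F by apply: sqintS sF.
have iD : mu.-integrable D (EFin \o (fun t => F t * phi t)).
  exact: (mul_integrable (measurable_itv _) (sFS _ _) (sp _ _)).
have e : (fun t => F t * phi t) = (fun t => F t * phi t) \_ D.
  apply/funext => t; rewrite patchE; case: ifPn => //.
  by rewrite notin_setE => /F0 ->; rewrite mul0r.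
split.
  have [h _] : mu.-integrable D (EFin \o (fun t => F t * phi t)) <->
      mu.-integrable setT ((EFin \o (fun t => F t * phi t)) \_ D).
    by apply: integrable_mkcond; exact: measurable_itv.
  by move: (h iD); rewrite restrict_EFin -e.
rewrite -/F [LHS](_ : _ = \int[mu]_(t in D) (F t * phi t)); last first.
  rewrite [RHS]Rintegral_mkcond; apply: eq_Rintegral => t _.
  exact: (congr1 (@^~ t) e).
rewrite /D Rintegral_split// -[RHS]ipC /periodize /window -/al.
rewrite (@ip_sumr _ _ (measurable_itv _) _ _ (fun (j : 'I_K) t => F (t + (j : nat)%:R * b)))//; last first.
  by move=> j; apply: sqintS (sqint_shift _ sF).
apply: eq_bigr => j _; rewrite /ip; apply: eq_Rintegral => t _.
by rewrite pp mulrC.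
Qed.

End Periodization.

(** * From frame bounds to the energies of periodizations *)

Section FrameCriterion.
Variables (R : realType) (a b c : R) (K : nat).
Hypotheses (a_gt0 : 0 < a) (b_gt0 : 0 < b) (c_le : c <= K%:R * b).
Local Notation mu := (@lebesgue_measure R).
Local Notation win := (window a b).
Local Notation per := (periodize a b c K).
Local Notation energy := (energy a b c K).
Local Notation C u m n := (ip (win m) (per u m) (fun t => cos (freq b n * t))).
Local Notation S u m n := (ip (win m) (per u m) (fun t => sin (freq b n * t))).
Local Notation coeff := (gabor_coeff_sq (chi0c c) (fun=> 0) a b).

(** The conjugated atom carries the factor [exp (2 pi i n t / b)], with a positive exponent;
    multiplying it by [u + i v] gives these signs. *)
Lemma gabor_coeffE (u v : R -> R) m n : sqint setT u -> sqint setT v ->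
  coeff u v (m, n) = ((C u m n - S v m n) ^+ 2 + (C v m n + S u m n) ^+ 2)%:E.
Proof.
move=> su sv.
have sc x y : sqint `[x, y[ (fun t => cos (freq b n * t)) by exact: sqint_cos.
have ss x y : sqint `[x, y[ (fun t => sin (freq b n * t)) by exact: sqint_sin.
have pc := cos_freq_shift b_gt0 n; have ps := sin_freq_shift b_gt0 n.
have [icu <-] := window_ip a b_gt0 c_le m su sc (fun j t => pc j t).
have [isu <-] := window_ip a b_gt0 c_le m su ss (fun j t => ps j t).
have [icv <-] := window_ip a b_gt0 c_le m sv sc (fun j t => pc j t).
have [isv <-] := window_ip a b_gt0 c_le m sv ss (fun j t => ps j t).
have fe t : 2 * pi * n%:~R * t / b = freq b n * t by rewrite /freq; ring.
rewrite /gabor_coeff_sq /inner_re /inner_im -RintegralB// -RintegralD//.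
congr ((_ ^+ 2 + _ ^+ 2)%:E); apply: eq_Rintegral => t _;
  by rewrite /gabor_re /gabor_im /= fe; ring.
Qed.

Lemma coef2E u m n : coef2 b (m%:~R * a) (per u m) n = (C u m n) ^+ 2 + (S u m n) ^+ 2.
Proof. by []. Qed.

Lemma double_inj (x y : \bar R) : (0 <= x)%E -> (0 <= y)%E -> (x + x = y + y)%E -> x = y.
Proof.
case: x => [x| |]; case: y => [y| |] //= _ _; rewrite -?EFinD// => -[h].
by congr EFin; lra.
Qed.

(** The cross terms [C u * S v] and [C v * S u] are odd in [n], so they cancel between the
    coefficients at [n] and [- n]. Both sides are doubled and one copy of the left one is reindexed
    by [n -> - n], which avoids splitting the sum by the sign of [n]. *)
Lemma esum_coeff (u v : R -> R) m : sqint setT u -> sqint setT v ->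
  (\esum_(n in [set: int]) coeff u v (m, n) =
   \esum_(n in [set: int]) (coef2 b (m%:~R * a) (per u m) n)%:E +
   \esum_(n in [set: int]) (coef2 b (m%:~R * a) (per v m) n)%:E)%E.
Proof.
move=> su sv; rewrite -esumD; try by move=> n _; rewrite lee_fin coef2_ge0.
have c0 n : (0 <= coeff u v (m, n))%E.
  by rewrite lee_fin addr_ge0 ?sqr_ge0.
apply: double_inj.
- by apply: esum_ge0.
- by apply: esum_ge0 => n _; rewrite -EFinD lee_fin addr_ge0 ?coef2_ge0.
rewrite {2}(reindex_esum [set: int] [set: int] (fun n => - n)); last first.
  split; [by []|by move=> x y _ _ /oppr_inj|].
  by move=> x _; exists (- x) => //; rewrite opprK.
have d0 n : (0 <= (coef2 b (m%:~R * a) (per u m) n)%:E + (coef2 b (m%:~R * a) (per v m) n)%:E)%E.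
  by rewrite -EFinD lee_fin addr_ge0 ?coef2_ge0.
rewrite -!esumD//; apply: eq_esum => n _.
rewrite !gabor_coeffE// !coef2E.
have cN w : C w m (- n) = C w m n.
  by rewrite /ip; apply: eq_Rintegral => t _; rewrite freqN mulNr cosN.
have sN w : sqint setT w -> S w m (- n) = - S w m n.
  move=> sw; rewrite -[RHS]mulN1r -ipZr; [|exact: measurable_itv|by apply: sqint_per => //; exact: measurable_itv|exact: sqint_sin].
  by rewrite /ip; apply: eq_Rintegral => t _; rewrite freqN mulNr sinN mulN1r.
by rewrite !cN !sN// -!EFinD; congr EFin; ring.
Qed.

Lemma esum_pair_coeff (u v : R -> R) : sqint setT u -> sqint setT v ->
  (\esum_(mn in [set: int * int]) coeff u v mn =
   \esum_(m in [set: int])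
     (\esum_(n in [set: int]) (coef2 b (m%:~R * a) (per u m) n)%:E +
      \esum_(n in [set: int]) (coef2 b (m%:~R * a) (per v m) n)%:E))%E.
Proof.
move=> su sv; rewrite -(eq_esum (fun m _ => esum_coeff m su sv)).
rewrite (esum_esum (J := fun=> [set: int]) (a := fun m n => coeff u v (m, n))); last first.
  by move=> m n _ _; rewrite lee_fin addr_ge0 ?sqr_ge0.
rewrite (_ : _ `*`` _ = [set: int * int]); last by apply/seteqP; split.
by apply: eq_esum => -[].
Qed.

Lemma energy_ge0 u m : (0 <= energy u m)%E.
Proof. by apply: integral_ge0 => t _; rewrite lee_fin sqr_ge0. Qed.

Lemma esumZ (r : R) (f : int -> \bar R) : 0 <= r -> (forall m, 0 <= f m)%E ->
  (\esum_(m in [set: int]) (r%:E * f m) = r%:E * \esum_(m in [set: int]) f m)%E.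
Proof.
move=> r0 f0.
have E (g : int -> \bar R) : (forall m, 0 <= g m)%E ->
    (\esum_(m in [set: int]) g m = \sum_(n <oo) g (int_of_nat n))%E.
  move=> g0; rewrite (reindex_esum [set: nat] [set: int] int_of_nat) ?nneseries_esumT//.
  exact: int_of_nat_bij.
have rf0 m : (0 <= r%:E * f m)%E by rewrite mule_ge0// lee_fin.
by rewrite !E// nneseriesZl.
Qed.

Lemma coeff_lower u v : sqint setT u -> sqint setT v ->
  ((b / 16)%:E * (\esum_(m in [set: int]) energy u m + \esum_(m in [set: int]) energy v m) <=
  \esum_(mn in [set: int * int]) coeff u v mn)%E.
Proof.
move=> su sv; rewrite esum_pair_coeff// -esumD; try by move=> *; exact: energy_ge0.
rewrite -esumZ; [|by rewrite divr_ge0 ?ltW|by move=> m; rewrite adde_ge0 ?energy_ge0].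
apply: le_esum => m _; rewrite ge0_muleDr ?energy_ge0//.
by apply: leeD; apply: fourier_lower => //; exact: sqint_per.
Qed.

Lemma coeff_upper u v : sqint setT u -> sqint setT v ->
  (\esum_(mn in [set: int * int]) coeff u v mn <=
  (2 * b)%:E * (\esum_(m in [set: int]) energy u m + \esum_(m in [set: int]) energy v m))%E.
Proof.
move=> su sv; rewrite esum_pair_coeff// -esumD; try by move=> *; exact: energy_ge0.
rewrite -esumZ; [|by rewrite mulr_ge0 ?ltW|by move=> m; rewrite adde_ge0 ?energy_ge0].
apply: le_esum => m _; rewrite ge0_muleDr ?energy_ge0//.
by apply: leeD; apply: fourier_upper => //; exact: sqint_per.
Qed.

Lemma sumr_sqr_le (n : nat) (x : nat -> R) :
  (\sum_(j < n) x j) ^+ 2 <= n%:R * \sum_(j < n) (x j) ^+ 2.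
Proof.
elim: n => [|n ih]; first by rewrite !big_ord0 expr0n/= mul0r.
rewrite !big_ord_recr/= -[n.+1]addn1 natrD.
set X := \sum_(_ < _) _ in ih *; set Y := \sum_(_ < _) _ in ih *.
(* After multiplication by [n] this follows from [X ^ 2 <= n * Y] and [0 <= (X - n * x n) ^ 2];
   cancelling [n] is why the case [n = 0] is set apart. *)
have : 2 * X * x n <= Y + n%:R * x n ^+ 2.
  case: n @X @Y ih => [|n] X Y ih.
    by rewrite /X /Y !big_ord0; lra.
  have n0 : (0 : R) < n.+1%:R by rewrite ltr0n.
  rewrite -(ler_pM2l n0).
  by have := sqr_ge0 (X - n.+1%:R * x n.+1); lra.
lra.
Qed.

(** In the constant, one factor [K] comes from Cauchy-Schwarz on the [K] terms of the periodization,
    another from the [K] translates of [u ^ 2], and [Q] bounds the overlap of the windows. *)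
Lemma energy_upper : exists2 B : R, 0 <= B & forall u, sqint setT u ->
  (\esum_(m in [set: int]) energy u m <= B%:E * \int[mu]_t ((u t) ^+ 2)%:E)%E.
Proof.
pose Q := (Num.truncn (b / a)).+1.
have bQ : b <= Q%:R * a.
  by rewrite -ler_pdivrMr// ltW// truncnS_gt.
exists (K%:R * (K%:R * Q%:R)); first by rewrite !mulr_ge0 ?ler0n.
move=> u su.
pose h t : \bar R := (\sum_(j < K) ((u (t + j%:R * b)) ^+ 2)%:E)%E.
have mj (j : nat) : measurable_fun setT (fun t : R => ((u (t + j%:R * b)) ^+ 2)%:E).
  by apply: measurable_sqr; have [] := sqint_shift (j%:R * b) su.
have mh : measurable_fun setT h by apply: emeasurable_sum => j; exact: mj.
have h0 t : (0 <= h t)%E by apply: sume_ge0 => j _; rewrite lee_fin sqr_ge0.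
have ih : (\int[mu]_t h t = K%:R%:E * \int[mu]_t ((u t) ^+ 2)%:E)%E.
  rewrite /h ge0_integral_sum//;
    [|by move=> j; exact: mj|by move=> j t _; rewrite lee_fin sqr_ge0].
  rewrite -sume_cst; last by apply: integral_ge0 => t _; rewrite lee_fin sqr_ge0.
  apply: eq_bigr => j _.
  rewrite [RHS](@ge0_integral_shift R (j%:R * b))//.
    by apply: measurable_sqr; have [] := su.
  by move=> t _; rewrite lee_fin sqr_ge0.
have le_m m : (energy u m <= K%:R%:E * \int[mu]_(t in win m) h t)%E.
  rewrite -ge0_integralZl//; try exact: measurable_itv; try exact: measurable_funTS.
  apply: ge0_le_integral => //.
  - exact: measurable_itv.
  - by move=> t _; rewrite lee_fin sqr_ge0.
  - have [mp _] : sqint (win m) (per u m) by apply: sqint_per => //; exact: measurable_itv.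
    exact: measurable_sqr.
  - by apply: emeasurable_funM; [exact: measurable_cst|exact: measurable_funTS].
  - move=> t _; rewrite /h sumEFin -EFinM lee_fin.
    apply: (le_trans (sumr_sqr_le _ (fun j => u (t + j%:R * b) * chi0c c (t + j%:R * b - m%:~R * a)))).
    apply: ler_wpM2l; first by rewrite ler0n.
    apply: ler_sum => j _; rewrite /chi0c; case: ifP => _; rewrite ?mulr1// mulr0 expr0n/=.
    exact: sqr_ge0.
apply: (@le_trans _ _ (K%:R%:E * (Q%:R%:E * \int[mu]_t h t))%E).
  apply: (@le_trans _ _ (K%:R%:E * \esum_(m in [set: int]) \int[mu]_(t in win m) h t)%E).
    rewrite -esumZ ?ler0n//; last by move=> m; exact: integral_ge0.
    by apply: le_esum => m _; exact: le_m.
  by apply: lee_wpmul2l; rewrite ?lee_fin ?ler0n//; exact: esum_overlap_le.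
by rewrite ih !muleA -!EFinM; apply: lee_wpmul2r;
  [apply: integral_ge0 => t _; rewrite lee_fin sqr_ge0|rewrite lee_fin; lra].
Qed.

Lemma L2_sqint (u v : R -> R) : L2 u v -> sqint setT u /\ sqint setT v.
Proof.
move=> [mu_ mv iuv].
have mw : measurable_fun setT (fun x => ((u x) ^+ 2 + (v x) ^+ 2)%:E).
  by apply/measurable_EFinP; apply: measurable_funD; exact: measurable_funX.
by split; split => //; apply: le_lt_trans iuv; apply: ge0_le_integral => //;
  rewrite ?lee_fin ?sqr_ge0//; try exact: measurable_sqr;
  move=> x _; rewrite lee_fin ?sqr_ge0// ?lerDl ?lerDr sqr_ge0.
Qed.

Lemma L2normsqE (u v : R -> R) : sqint setT u -> sqint setT v ->
  (L2normsq u v = \int[mu]_t ((u t) ^+ 2)%:E + \int[mu]_t ((v t) ^+ 2)%:E)%E.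
Proof.
move=> su sv; have [mu_ _] := su; have [mv _] := sv; rewrite /L2normsq -ge0_integralD//;
  try exact: measurable_sqr; by move=> t _; rewrite lee_fin sqr_ge0.
Qed.

Lemma frame_of_lower (A : R) : 0 < A ->
  (forall u, sqint setT u ->
    (A%:E * \int[mu]_t ((u t) ^+ 2)%:E <= \esum_(m in [set: int]) energy u m)%E) ->
  gabor_frame (chi0c c) (fun=> 0) a b.
Proof.
move=> A0 lo; have [B B0 up] := energy_upper.
(* The upper constant includes the lower one so that the two are ordered as the definition of a
   frame demands. *)
exists (b / 16 * A), (b / 16 * A + 2 * b * B); split.
- by rewrite mulr_gt0// divr_gt0.
- by rewrite lerDl !mulr_ge0// ltW.
move=> u v uv; have [su sv] := L2_sqint uv; rewrite L2normsqE//.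
have sq0 w : (0 <= \int[mu]_t ((w t) ^+ 2)%:E :> \bar R)%E.
  by apply: integral_ge0 => t _; rewrite lee_fin sqr_ge0.
split.
  apply: le_trans (coeff_lower su sv); rewrite EFinM -muleA.
  apply: lee_wpmul2l; first by rewrite lee_fin divr_ge0 ?ltW.
  by rewrite ge0_muleDr//; apply: leeD; exact: lo.
apply: (le_trans (coeff_upper su sv)).
apply: (@le_trans _ _ ((2 * b)%:E * (B%:E * (\int[mu]_t ((u t) ^+ 2)%:E + \int[mu]_t ((v t) ^+ 2)%:E)))%E).
  apply: lee_wpmul2l; first by rewrite lee_fin mulr_ge0 ?ltW.
  by rewrite ge0_muleDr//; apply: leeD; exact: up.
rewrite muleA -EFinM; apply: lee_wpmul2r; first exact: adde_ge0.
by rewrite lee_fin lerDr !mulr_ge0 ?ltW// divr_ge0 ?ltW.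
Qed.

Lemma lower_of_frame : gabor_frame (chi0c c) (fun=> 0) a b ->
  exists2 A : R, 0 < A & forall u, sqint setT u ->
    (A%:E * \int[mu]_t ((u t) ^+ 2)%:E <= \esum_(m in [set: int]) energy u m)%E.
Proof.
move=> [A [B [A0 _ fr]]]; have b2 : 0 < 2 * b by rewrite mulr_gt0.
exists ((2 * b)^-1 * A); first by rewrite mulr_gt0 ?invr_gt0.
move=> u su; have s0 := sqint0 (@setT R); have [mu_ iu] := su.
have uv : L2 u (fun=> 0).
  split => //; under eq_integral do rewrite expr0n/= addr0; exact: iu.
have [h _] := fr _ _ uv; have := le_trans h (coeff_upper su s0).
rewrite L2normsqE// (_ : (\int[mu]_t (0 ^+ 2)%:E = 0)%E); last first.
  by under eq_integral do rewrite expr0n/=; rewrite integral0.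
rewrite adde0 (_ : \esum_(m in _) energy (fun=> 0) m = 0%E); last first.
  apply: esum1 => m _; rewrite /energy; apply: integral0_eq => t _.
  by rewrite /periodize big1 ?expr0n// => j _; rewrite mul0r.
rewrite adde0 => h2; rewrite EFinM -muleA.
have i0 : (0 <= ((2 * b)^-1)%:E)%E by rewrite lee_fin invr_ge0 ltW.
have := lee_wpmul2l i0 h2.
by rewrite (muleA _ (2 * b)%:E) -EFinM mulVf ?gt_eqF// mul1e.
Qed.

End FrameCriterion.

(** * Lower bound from orbits meeting the bad set *)

Section LowerBound.
Variables (R : realType) (a b c : R) (K : nat).
Hypotheses (a_gt0 : 0 < a) (ab : a <= b).
Variables (N L : nat) (Bad : R -> Prop).
Hypotheses (N_gt0 : (0 < N)%N) (L_gt0 : (0 < L)%N).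
Local Notation mu := (@lebesgue_measure R).
Local Notation win := (window a b).
Local Notation per := (periodize a b c K).
Local Notation energy := (energy a b c K).
Local Notation tile := (tile a).

Definition hit (t : R) := exists2 j : nat, (j < L)%N & Bad (t + j%:R * (N%:R * b)).

Hypothesis per_bad : forall (u : R -> R) m t, tile m t -> Bad t ->
  per u m t - per u (m + 1) (t + b) = u t.
Hypothesis per_good : forall (u : R -> R) m t, tile m t -> ~ Bad t ->
  per u m t - per u (m + 1) (t + b) = u t - u (t + N%:R * b).
Hypothesis per_sum : forall (u : R -> R) m t, tile m t -> ~ Bad t ->
  per u m t = \sum_(j < N) u (t + j%:R * b).
Hypothesis hits : forall t, hit t \/ forall r : nat, (0 < r < N)%N -> hit (t + r%:R * b).

Section Fixed.
Variable u : R -> R.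
Hypothesis su : sqint setT u.

Let fl (t : R) : int := Num.floor (t / a).
Let G (t : R) : R := per u (fl t) t.
(** The difference is read on the tile that contains [t]. Since [a <= b], the point [t + b] then
    lies in the window of index [fl t + 1]. *)
Let d (t : R) : R := per u (fl t) t - per u (fl t + 1) (t + b).

Let flE m t : tile m t -> fl t = m.
Proof. by move=> tm; apply: (tile_inj a_gt0) tm; exact: tile_floor. Qed.

Let b_gt0 : 0 < b. Proof. exact: lt_le_trans a_gt0 ab. Qed.

Lemma chain_bad j t : Bad (t + j%:R * (N%:R * b)) ->
  `|u t| <= \sum_(i < j.+1) `|d (t + i%:R * (N%:R * b))|.
Proof.
elim: j t => [|j ih] t.
  rewrite mul0r addr0 big_ord1 mul0r addr0 => Bt.
  by rewrite /d per_bad//; exact: tile_floor.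
move=> Bt; rewrite big_ord_recl/= mul0r addr0.
case: (pselect (Bad t)) => [Bt0|nB].
  rewrite {1}/d per_bad//; last exact: tile_floor.
  by rewrite lerDl sumr_ge0.
have e (i : nat) : t + i.+1%:R * (N%:R * b) = t + N%:R * b + i%:R * (N%:R * b).
  by rewrite -addn1 natrD; ring.
have -> : u t = d t + u (t + N%:R * b).
  by rewrite /d per_good//; [rewrite subrK|exact: tile_floor].
apply: (le_trans (ler_normD _ _)); rewrite lerD2l.
rewrite (eq_bigr (fun i : 'I_j.+1 => `|d (t + N%:R * b + i%:R * (N%:R * b))|)); last first.
  by move=> i _; rewrite /= /bump /= -e.
by apply: ih; rewrite -e.
Qed.

Definition chain (t : R) : R := \sum_(i < L) `|d (t + i%:R * (N%:R * b))|.

Lemma chain_ge0 t : 0 <= chain t. Proof. exact: sumr_ge0. Qed.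

Lemma hit_chain t : hit t -> `|u t| <= chain t.
Proof.
move=> [j jL Bj]; apply: (le_trans (chain_bad Bj)).
rewrite /chain -(big_mkord xpredT (fun i => `|d (t + i%:R * (N%:R * b))|)).
rewrite -(big_mkord xpredT (fun i => `|d (t + i%:R * (N%:R * b))|)).
rewrite (@big_cat_nat _ _ _ j.+1 0 L)//= lerDl.
by apply: sumr_ge0.
Qed.

(** If the orbit of [t] is hit, the chain at [r = 0] suffices. Otherwise [t] itself is not bad,
    [G t] is the sum of [u] over [N] points, and the [N - 1] points other than [t] are bounded by
    their chains. *)
Lemma pointwise_bound t : `|u t| <= `|G t| + \sum_(r < N) chain (t + r%:R * b).
Proof.
have S0 : 0 <= \sum_(r < N) chain (t + r%:R * b).
  by apply: sumr_ge0 => r _; exact: chain_ge0.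
have [ht|nh] := pselect (hit t).
  apply: (le_trans (hit_chain ht)).
  rewrite (bigD1 (Ordinal N_gt0))//= mul0r addr0 addrCA lerDl addr_ge0//.
  by apply: sumr_ge0 => r _; exact: chain_ge0.
have [//|hr] := hits t.
have nB : ~ Bad t by move=> Bt; apply: nh; exists 0%N; rewrite // mul0r addr0.
have Ge : G t = \sum_(j < N) u (t + j%:R * b).
  by apply: per_sum => //; exact: tile_floor.
move: Ge; rewrite (bigD1 (Ordinal N_gt0))//= mul0r addr0 => Ge.
have -> : u t = G t - \sum_(i < N | i != Ordinal N_gt0) u (t + i%:R * b).
  by rewrite Ge addrK.
apply: (le_trans (ler_normB _ _)); rewrite lerD2l.
apply: (le_trans (ler_norm_sum _ _ _)).
rewrite [leRHS](bigD1 (Ordinal N_gt0))//= -[leLHS]add0r.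
apply: lerD; first exact: chain_ge0.
apply: ler_sum => i i0; apply: hit_chain; apply: hr.
by rewrite ltn_ord andbT lt0n; apply: contra i0 => /eqP h; apply/eqP/val_inj.
Qed.

Lemma pointwise_sqr t : (u t) ^+ 2 <= 2 * (G t) ^+ 2 +
  2 * (N%:R * L%:R) * \sum_(r < N) \sum_(i < L) (d (t + r%:R * b + i%:R * (N%:R * b))) ^+ 2.
Proof.
have h := pointwise_bound t; set Y := \sum_(r < N) _ in h.
have Y0 : 0 <= Y by apply: sumr_ge0 => r _; exact: chain_ge0.
have h2 : (u t) ^+ 2 <= (`|G t| + Y) ^+ 2.
  by rewrite -[leLHS]real_normK ?num_real// lerXn2r ?nnegrE ?addr_ge0.
have h3 : (`|G t| + Y) ^+ 2 <= 2 * (G t) ^+ 2 + 2 * Y ^+ 2.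
  by rewrite -[X in 2 * X + _]real_normK ?num_real//; have := sqr_ge0 (`|G t| - Y); lra.
apply: (le_trans h2); apply: (le_trans h3); rewrite lerD2l -mulrA ler_pM2l//.
apply: (le_trans (sumr_sqr_le _ (fun r => chain (t + r%:R * b)))).
rewrite -mulrA; apply: ler_wpM2l; first by rewrite ler0n.
rewrite mulr_sumr; apply: ler_sum => r _.
apply: (le_trans (sumr_sqr_le _ (fun i => `|d (t + r%:R * b + i%:R * (N%:R * b))|))).
apply: ler_wpM2l; first by rewrite ler0n.
by apply: ler_sum => i _; rewrite real_normK ?num_real.
Qed.

Let mper m D : measurable D -> measurable_fun D (per u m).
Proof. by move=> mD; have [] := sqint_per a b c K m mD su. Qed.

Let mperb m D : measurable D -> measurable_fun D (fun t : R => per u m (t + b)).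
Proof.
move=> mD; apply: measurable_funTS; apply: measurableT_comp; first exact: mper.
exact: measurable_shift.
Qed.

Let mG : measurable_fun setT G.
Proof.
apply: (measurable_fun_tile a_gt0) => m.
apply: (eq_measurable_fun (per u m)); last by apply: mper; exact: measurable_tile.
by move=> t; rewrite inE => tm; rewrite /G (flE tm).
Qed.

Let md : measurable_fun setT d.
Proof.
apply: (measurable_fun_tile a_gt0) => m.
apply: (eq_measurable_fun (fun t => per u m t - per u (m + 1) (t + b))).
  by move=> t; rewrite inE => tm; rewrite /d (flE tm).
by apply: measurable_funB; [apply: mper|apply: mperb]; exact: measurable_tile.
Qed.

Let tile_win m : tile m `<=` win m.
Proof.
move=> t; rewrite /tile /window /= !in_itv/= => /andP[-> h]/=; apply: (lt_le_trans h).
by rewrite intrD mulrDl mul1r lerD2l.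
Qed.

Let mwin m : measurable (win m). Proof. exact: measurable_itv. Qed.

Lemma tile_energy m : (\int[mu]_(t in tile m) ((per u m t) ^+ 2)%:E <= energy u m)%E.
Proof.
apply: ge0_subset_integral => //.
- exact: measurable_tile.
- exact: mwin.
- exact: measurable_sqr (mper _ (mwin m)).
- by move=> t _; rewrite lee_fin sqr_ge0.
Qed.

(** Since [a <= b], translation by [b] carries the tile of index [m] onto the last part of the
    window of index [m + 1]. *)
Lemma tile_energy_next m :
  (\int[mu]_(t in tile m) ((per u (m + 1) (t + b)) ^+ 2)%:E <= energy u (m + 1)%R)%E.
Proof.
pose T : set R := `[(m%:~R * a) + b, (m + 1)%:~R * a + b[%classic.
have mT : measurable T by exact: measurable_itv.
have mp : measurable_fun T (fun t => ((per u (m + 1) t) ^+ 2)%:E).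
  by apply: measurable_sqr; apply: mper.
have -> : (\int[mu]_(t in tile m) ((per u (m + 1) (t + b)) ^+ 2)%:E =
    \int[mu]_(t in T) ((per u (m + 1) t) ^+ 2)%:E)%E.
  rewrite [RHS](@ge0_integral_shift R b)//; last by move=> t _; rewrite lee_fin sqr_ge0.
  congr (integral _ _ _); apply/seteqP; split => t; rewrite /tile /T /= !in_itv/=; lra.
apply: ge0_subset_integral => //.
- exact: mwin.
- exact: measurable_sqr (mper _ (mwin (m + 1))).
- by move=> t _; rewrite lee_fin sqr_ge0.
- move=> t; rewrite /T /window /= !in_itv/= => /andP[h1 h2]; rewrite h2 andbT.
  by apply: le_trans h1; rewrite intrD mulrDl mul1r lerD2l.
Qed.

Lemma integral_G : (\int[mu]_t ((G t) ^+ 2)%:E <= \esum_(m in [set: int]) energy u m)%E.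
Proof.
rewrite -(integral_tile a_gt0); [|exact: measurable_sqr|by move=> t; rewrite lee_fin sqr_ge0].
apply: le_esum => m _; apply: le_trans (tile_energy m).
rewrite le_eqVlt; apply/orP; left; apply/eqP; apply: eq_integral => t; rewrite inE => tm.
by rewrite /G (flE tm).
Qed.

(** By [(x - y) ^ 2 <= 2 x ^ 2 + 2 y ^ 2], each energy is counted with weight 2 for its own tile and
    with weight 2 for the preceding one. *)
Lemma integral_d :
  (\int[mu]_t ((d t) ^+ 2)%:E <= 4%:E * \esum_(m in [set: int]) energy u m)%E.
Proof.
rewrite -(integral_tile a_gt0); [|exact: measurable_sqr|by move=> t; rewrite lee_fin sqr_ge0].
apply: (@le_trans _ _ (\esum_(m in [set: int]) (2%:E * energy u m + 2%:E * energy u (m + 1)%R))%E).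
  apply: le_esum => m _.
  have mt := measurable_tile a m.
  apply: (@le_trans _ _ (\int[mu]_(t in tile m)
     (2%:E * ((per u m t) ^+ 2)%:E + 2%:E * ((per u (m + 1) (t + b)) ^+ 2)%:E))%E).
    apply: ge0_le_integral => //.
    + by move=> t _; rewrite lee_fin sqr_ge0.
    + by apply: measurable_sqr; apply: measurable_funTS.
    + apply: emeasurable_funD; apply: emeasurable_funM; try exact: measurable_cst.
      * by apply: measurable_sqr; exact: mper.
      * by apply: measurable_sqr; exact: mperb.
    + move=> t tm; rewrite -!EFinM -EFinD lee_fin /d (flE tm).
      by have := sqr_ge0 (per u m t + per u (m + 1) (t + b)); lra.
  have p0 (f : R -> R) : (0 <= \int[mu]_(t in tile m) ((f t) ^+ 2)%:E)%E.
    by apply: integral_ge0 => t _; rewrite lee_fin sqr_ge0.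
  have m1 := measurable_sqr (mper m mt); have m2 := measurable_sqr (mperb (m + 1) mt).
  have q1 t : (0 <= ((per u m t) ^+ 2)%:E)%E by rewrite lee_fin sqr_ge0.
  have q2 t : (0 <= ((per u (m + 1) (t + b)) ^+ 2)%:E)%E by rewrite lee_fin sqr_ge0.
  rewrite ge0_integralD//; last first.
  - by apply: emeasurable_funM => //; exact: measurable_cst.
  - by move=> t _; rewrite mule_ge0.
  - by apply: emeasurable_funM => //; exact: measurable_cst.
  - by move=> t _; rewrite mule_ge0.
  rewrite !ge0_integralZl//.
  by apply: leeD; apply: lee_wpmul2l => //; [exact: tile_energy|exact: tile_energy_next].
have e0 := energy_ge0 a b c K u.
rewrite esumD; try by move=> m _; rewrite mule_ge0.
rewrite !esumZ// (esum_shift_int (energy u)).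
by rewrite -ge0_muleDl ?lee_fin// -EFinD; apply: lee_wpmul2r;
  [exact: esum_ge0|rewrite lee_fin; lra].
Qed.

(** The 2 belongs to [G]. In [8 (N L) ^ 2 = (2 N L) * (N L) * 4] the factors are the weight in
    [pointwise_sqr], the number of translates of [d], and the constant of [integral_d]. *)
Lemma lower_bound_fixed :
  (\int[mu]_t ((u t) ^+ 2)%:E <=
   (2 + 8 * (N%:R * L%:R) ^+ 2)%:E * \esum_(m in [set: int]) energy u m)%E.
Proof.
set E := \esum_(m in _) _.
have E0 : (0 <= E)%E by apply: esum_ge0 => m _; exact: energy_ge0.
pose NL : R := N%:R * L%:R.
pose H t : \bar R := (\sum_(r < N) \sum_(i < L)
   ((d (t + r%:R * b + i%:R * (N%:R * b))) ^+ 2)%:E)%E.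
have mds (s1 s2 : R) : measurable_fun setT (fun t : R => ((d (t + s1 + s2)) ^+ 2)%:E).
  apply: measurable_sqr; apply: (measurableT_comp md).
  apply: (@measurableT_comp _ _ _ _ _ _ (fun t : R => t + s2)); exact: measurable_shift.
have mH : measurable_fun setT H.
  by apply: emeasurable_sum => r; apply: emeasurable_sum => i; exact: mds.
have H0 t : (0 <= H t)%E.
  by apply: sume_ge0 => r _; apply: sume_ge0 => i _; rewrite lee_fin sqr_ge0.
have IH : (\int[mu]_t H t = NL%:E * \int[mu]_t ((d t) ^+ 2)%:E)%E.
  have I0 : (0 <= \int[mu]_t ((d t) ^+ 2)%:E)%E.
    by apply: integral_ge0 => t _; rewrite lee_fin sqr_ge0.
  have sh (s1 s2 : R) : (\int[mu]_t ((d (t + s1 + s2)) ^+ 2)%:E = \int[mu]_t ((d t) ^+ 2)%:E)%E.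
    rewrite [RHS](@ge0_integral_shift R (s1 + s2))//.
    - by apply: eq_integral => t _; rewrite addrA.
    - exact: measurable_sqr.
    - by move=> t _; rewrite lee_fin sqr_ge0.
  rewrite /H ge0_integral_sum//; last first.
  - by move=> r t _; apply: sume_ge0 => i _; rewrite lee_fin sqr_ge0.
  - by move=> r; apply: emeasurable_sum => i; exact: mds.
  rewrite (eq_bigr (fun=> L%:R%:E * \int[mu]_t ((d t) ^+ 2)%:E)%E); last first.
    move=> r _; rewrite ge0_integral_sum//; last first.
    - by move=> i t _; rewrite lee_fin sqr_ge0.
    - by move=> i; exact: mds.
    by rewrite -sume_cst//; apply: eq_bigr => i _; exact: sh.
  by rewrite sume_cst ?mule_ge0 ?lee_fin ?ler0n// muleA -EFinM.
have mG2 := measurable_sqr mG.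
have g0 t : (0 <= ((G t) ^+ 2)%:E)%E by rewrite lee_fin sqr_ge0.
have nl0 : 0 <= 2 * NL by rewrite !mulr_ge0 ?ler0n.
apply: (@le_trans _ _ (\int[mu]_t (2%:E * ((G t) ^+ 2)%:E + (2 * NL)%:E * H t))%E).
  apply: ge0_le_integral => //.
  + by move=> t _; rewrite lee_fin sqr_ge0.
  + by apply: measurable_sqr; have [] := su.
  + by apply: emeasurable_funD; apply: emeasurable_funM => //; exact: measurable_cst.
  + move=> t _; rewrite /H; under eq_bigr do rewrite sumEFin.
    rewrite sumEFin -!EFinM -EFinD lee_fin.
    exact: pointwise_sqr.
rewrite ge0_integralD//; last first.
- by apply: emeasurable_funM => //; exact: measurable_cst.
- by move=> t _; rewrite mule_ge0 ?lee_fin.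
- by apply: emeasurable_funM => //; exact: measurable_cst.
- by move=> t _; rewrite mule_ge0.
rewrite !ge0_integralZl//; try by rewrite lee_fin.
rewrite IH.
apply: (@le_trans _ _ (2%:E * E + (2 * NL)%:E * (NL%:E * (4%:E * E)))%E).
  apply: leeD; first by apply: lee_wpmul2l => //; exact: integral_G.
  apply: lee_wpmul2l; first by rewrite lee_fin.
  apply: lee_wpmul2l; first by rewrite lee_fin mulr_ge0 ?ler0n.
  exact: integral_d.
rewrite !muleA -!EFinM -ge0_muleDl ?lee_fin//; last by rewrite !mulr_ge0 ?ler0n.
by apply: lee_wpmul2r => //; rewrite -EFinD lee_fin -/NL; lra.
Qed.

End Fixed.

Lemma frame_of_hits : c <= K%:R * b -> gabor_frame (chi0c c) (fun=> 0) a b.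
Proof.
move=> cK; have b0 : 0 < b by exact: lt_le_trans a_gt0 ab.
set B : R := 2 + 8 * (N%:R * L%:R) ^+ 2.
have B0 : 0 < B by rewrite /B; have := sqr_ge0 (N%:R * L%:R : R); lra.
apply: (@frame_of_lower R a b c K _ _ _ B^-1) => //; first by rewrite invr_gt0.
move=> u su; have h := lower_bound_fixed su.
have i0 : (0 <= (B^-1)%:E)%E by rewrite lee_fin invr_ge0 ltW.
by have := lee_wpmul2l i0 h; rewrite (muleA _ B%:E) -EFinM mulVf ?gt_eqF// mul1e.
Qed.

End LowerBound.

(** * Index pattern of the test functions *)

Section Comb.
Variables (N J : nat).

(* [comb l - comb (l - r)] is the value of the test function on the slot of index [l]. *)
Definition comb (l : int) : bool := [&& 0 <= l, l < (J * N)%:Z & (N%:Z %| l)%Z].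

(** Exactly one of [N] consecutive indices, here [l + j0], is a multiple of [N]; as such it lies in
    [[0, J N)] precisely when [- N < l <= J N - N]. *)
Lemma comb_window (R : realType) (l : int) : (0 < N)%N ->
  \sum_(j < N) (comb (l + (j : nat)%:Z))%:R =
  ((- N%:Z < l) && (l <= (J * N)%:Z - N%:Z))%:R :> R.
Proof.
move=> N0.
have m1 : 0 <= (- l %% N%:Z)%Z by apply: modz_ge0; lia.
have m2 : (- l %% N%:Z)%Z < N%:Z by apply: ltz_pmod; lia.
pose j0 := `|(- l %% N%:Z)%Z|%N.
have j0E : j0%:Z = (- l %% N%:Z)%Z by rewrite /j0 gez0_abs.
have jN : (j0 < N)%N by lia.
have dv : (N%:Z %| l + j0%:Z)%Z.
  have : (N%:Z %| j0%:Z - (- l))%Z by rewrite -eqz_mod_dvd j0E modz_mod.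
  by rewrite opprK addrC.
rewrite (bigD1 (Ordinal jN))//= big1 ?addr0; last first.
  move=> i ij; rewrite /comb; case: (boolP (_ %| _)%Z) => [di|]; last by rewrite !andbF.
  have : (N%:Z %| (l + (i : nat)%:Z) - (l + j0%:Z))%Z by apply: rpredB.
  move/negP: ij => ij; rewrite (_ : _ - _ = (i : nat)%:Z - j0%:Z); last by ring.
  move=> /dvdzP[q Hq]; exfalso; apply: ij; apply/eqP/val_inj => /=.
  have iN := ltn_ord i; have q0 : q = 0 by nia.
  by move: Hq; rewrite q0; lia.
rewrite /comb dv andbT; congr ((nat_of_bool _)%:R).
move/dvdzP: dv => [q Hq]; rewrite Hq.
have h1 : (0 <= q * N%:Z) = (- N%:Z < l).
  by have [q0|q0] := leP 0 q; [have : 0 <= q * N%:Z by nia|have : q * N%:Z <= - N%:Z by nia]; lia.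
have h2 : (q * N%:Z < (J * N)%:Z) = (l <= (J * N)%:Z - N%:Z).
  by have [q0|q0] := ltP q J%:Z;
    [have : q * N%:Z <= (J * N)%:Z - N%:Z by nia|have : (J * N)%:Z <= q * N%:Z by nia]; lia.
by rewrite h1 h2.
Qed.

Lemma comb_disj (r : nat) l : (0 < r < N)%N -> comb l -> ~~ comb (l - r%:Z).
Proof.
move=> /andP[r_gt0 r_lt] /and3P[_ _ d1]; apply/negP => /and3P[_ _ d2].
have : (N%:Z %| l - (l - r%:Z))%Z by apply: rpredB.
rewrite (_ : _ - _ = r%:Z); last by ring.
move=> /dvdzP[q Hq]; have [q0|q0] := leP q 0.
  have h : q * N%:Z <= 0 by nia.
  by lia.
have h : N%:Z <= q * N%:Z by nia.
by lia.
Qed.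

End Comb.

(** * Test functions violating the lower bound *)

Section NotFrame.
Variables (R : realType) (a b c : R) (K N r : nat) (t0 delta : R).
Hypotheses (a_gt0 : 0 < a) (b_gt0 : 0 < b) (c_le : c <= K%:R * b).
Hypotheses (r_gt0 : (0 < r)%N) (r_lt : (r < N)%N) (NK : (N <= K)%N).
Hypotheses (delta_gt0 : 0 < delta) (delta_le : delta <= b).
Local Notation mu := (@lebesgue_measure R).

Definition slot (l : int) : set R := `[t0 + l%:~R * b, t0 + l%:~R * b + delta[%classic.

Hypothesis window_eq : forall (l m : int) t,
  (N%:Z %| l)%Z \/ (N%:Z %| l - r%:Z)%Z -> slot l t ->
  chi0c c (t - m%:~R * a) = chi0c (N%:R * b) (t - m%:~R * a).

(** Index of the period [[t0 + l b, t0 + (l + 1) b)] that contains [t]. As [delta <= b], the slot of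
    index [l] stays inside this period, so only the slot of index [fl t] can contain [t]. *)
Let fl (t : R) : int := Num.floor ((t - t0) / b).
Let on (t : R) : bool := t < t0 + (fl t)%:~R * b + delta.

Let fl_itv t : t0 + (fl t)%:~R * b <= t < t0 + (fl t + 1)%:~R * b.
Proof.
have := tile_floor b_gt0 (t - t0); rewrite /tile /= in_itv/= -/(fl t).
by rewrite lerBrDl ltrBlDl.
Qed.

Let slotE l t : slot l t <-> l = fl t /\ on t.
Proof.
have /andP[h1 h2] := fl_itv t; rewrite /slot /= in_itv/= /on; split.
  move=> /andP[h3 h4]; have e : l = fl t.
    have : l%:~R * b < (fl t + 1)%:~R * b by lra.
    have : (fl t)%:~R * b < (l + 1)%:~R * b.
      rewrite [(l + 1)%:~R]intrD mulrDl mul1r -(ltrD2l t0) addrA.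
      by rewrite (le_lt_trans h1)// (lt_le_trans h4)// lerD2l.
    by rewrite !ltr_pM2r// !ltr_int; lia.
  by split => //; rewrite -e.
by move=> [-> ->]; rewrite h1.
Qed.

Let indic_slot l t : \1_(slot l) t = ((l == fl t) && on t)%:R :> R.
Proof.
rewrite indicE; congr ((nat_of_bool _)%:R); apply/idP/idP.
  by rewrite inE => /slotE[-> ->]; rewrite eqxx.
by move=> /andP[/eqP e o]; apply/mem_set/slotE.
Qed.

Let fl_shift t (j : nat) : fl (t + j%:R * b) = fl t + j%:Z /\ on (t + j%:R * b) = on t.
Proof.
have E : fl (t + j%:R * b) = fl t + j%:Z.
  have /andP[h1 h2] := fl_itv t; have /andP[h3 h4] := fl_itv (t + j%:R * b).
  have e1 : (fl t + j%:Z)%:~R * b = (fl t)%:~R * b + j%:R * b by rewrite intrD mulrDl.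
  have : (fl t + j%:Z)%:~R * b < (fl (t + j%:R * b) + 1)%:~R * b by lra.
  have : (fl (t + j%:R * b))%:~R * b < (fl t + j%:Z + 1)%:~R * b.
    by rewrite intrD mulrDl e1 mul1r; rewrite intrD mulrDl mul1r in h2; lra.
  by rewrite !ltr_pM2r// !ltr_int; lia.
split=> //; rewrite /on E intrD mulrDl.
by rewrite (_ : t0 + _ + delta = t0 + (fl t)%:~R * b + delta + j%:R * b) ?ltrD2r//; ring.
Qed.

Let measurable_slot l : measurable (slot l). Proof. exact: measurable_itv. Qed.

Let mu_slot l : mu (slot l) = delta%:E.
Proof.
rewrite lebesgue_measure_itv/= lte_fin ltrDl delta_gt0 -EFinB; congr EFin; ring.
Qed.

Let mslot l : measurable_fun setT (fun t : R => (\1_(slot l) t)%:E : \bar R).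
Proof. by apply/measurable_EFinP; apply: measurable_indic; exact: measurable_slot. Qed.

Let integral_slot l : (\int[mu]_x (\1_(slot l) x)%:E = delta%:E)%E.
Proof.
rewrite integral_indic; [|exact: measurableT|exact: measurable_slot].
rewrite (_ : _ `&` _ = slot l); first exact: mu_slot.
by apply/seteqP; split => [x []|x].
Qed.

Let sqint_slot l : sqint setT (\1_(slot l) : R -> R).
Proof.
split; first by apply: measurable_indic.
rewrite (_ : (\int[mu]_x ((\1_(slot l) x) ^+ 2)%:E = \int[mu]_x (\1_(slot l) x)%:E)%E).
  by rewrite integral_slot ltry.
by apply: eq_integral => x _; rewrite indicE; case: (_ \in _); rewrite ?expr1n ?expr0n.
Qed.

Section Test.
Variable J : nat.
Let cb := comb N J.

(** The extra block of [N] indices makes room for the shift by [r < N]: outside the range both combs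
    vanish. *)
Definition test (t : R) : R :=
  \sum_(i < J.+1 * N) ((cb (i : nat)%:Z)%:R - (cb ((i : nat)%:Z - r%:Z))%:R) * \1_(slot (i : nat)%:Z) t.

Lemma testE t : test t = ((cb (fl t))%:R - (cb (fl t - r%:Z))%:R) * (on t)%:R.
Proof.
rewrite /test.
have [/andP[f0 fM]|out] := boolP ((0 <= fl t) && (fl t < (J.+1 * N)%:Z)).
  have iM : (`|fl t| < J.+1 * N)%N by lia.
  have ie : (Ordinal iM : nat)%:Z = fl t by rewrite /= gez0_abs.
  rewrite (bigD1 (Ordinal iM))//= [X in _ + X]big1 ?addr0; last first.
    move=> i ii; rewrite indic_slot (_ : (_ == _) = false) ?mulr0//.
    by apply/negP => /eqP e; move/negP: ii; apply; apply/eqP/val_inj => /=; lia.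
  by rewrite indic_slot !ie eqxx.
rewrite big1; last first.
  move=> i _; rewrite indic_slot (_ : (_ == _) = false) ?mulr0//.
  by apply/negP => /eqP e; move/negP: out; apply; have := ltn_ord i; lia.
have c1 : cb (fl t) = false.
  by apply/negP => /and3P[h1 h2 _]; move/negP: out; apply; lia.
have c2 : cb (fl t - r%:Z) = false.
  by apply/negP => /and3P[h1 h2 _]; move/negP: out; apply; lia.
by rewrite c1 c2 subrr mul0r.
Qed.

Lemma sqint_test : sqint setT test.
Proof. by apply: sqint_sum => // i; apply: sqintZ => //; exact: sqint_slot. Qed.

(** Only the slots of value 1, at the indices [0, N, ..., (J - 1) N], are counted; [comb_disj]
    excludes cancellation on them. *)
Lemma test_lower : ((J%:R * delta)%:E <= \int[mu]_t ((test t) ^+ 2)%:E)%E.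
Proof.
have -> : ((J%:R * delta)%:E = \int[mu]_t (\sum_(j < J) (\1_(slot (j * N)%:Z) t)%:E))%E.
  rewrite ge0_integral_sum//; last by move=> j; exact: mslot.
  rewrite (eq_bigr (fun=> delta%:E)) ?sume_cst ?lee_fin ?ltW ?EFinM//.
apply: ge0_le_integral => //.
- by move=> t _; apply: sume_ge0 => j _; rewrite lee_fin.
- by apply: emeasurable_sum => j; exact: mslot.
- by apply: measurable_sqr; have [] := sqint_test.
move=> t _; rewrite sumEFin lee_fin testE.
under eq_bigr do rewrite indic_slot.
have [ont|] := boolP (on t); last by rewrite mulr0 expr0n/= => _; rewrite big1// => j _; rewrite andbF.
under eq_bigr do rewrite andbT.
rewrite mulr1; have [cbt|ncb] := boolP (cb (fl t)).
  have /negPf nc : ~~ cb (fl t - r%:Z) by apply: comb_disj cbt; rewrite r_gt0.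
  rewrite nc subr0 expr1n.
  move: cbt => /and3P[f0 fJ /dvdzP[q Hq]].
  have qJ : (`|q| < J)%N by nia.
  rewrite (bigD1 (Ordinal qJ))//= big1 ?addr0; first by case: (_ == _).
  move=> j jq; apply/eqP; rewrite pnatr_eq0 eqb0; apply: contra jq => /eqP jf.
  by apply/eqP/val_inj => /=; nia.
rewrite big1 ?sqr_ge0// => j _; case: eqP => // e; exfalso; move/negP: ncb; apply.
rewrite -e /cb /comb; apply/and3P; split; [lia| |by rewrite PoszM dvdz_mull].
by have := ltn_ord j; nia.
Qed.

(** Wherever the test function is nonzero, [window_eq] replaces the window of length [c] by one of
    length [N b], and this one contains [t + j b] exactly for [j < N]. *)
Lemma per_test m t : window a b m t ->
  periodize a b c K test m t = \sum_(j < N) test (t + j%:R * b).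
Proof.
rewrite /window /= in_itv/= => /andP[t1 t2]; rewrite /periodize.
have E j : test (t + j%:R * b) * chi0c c (t + j%:R * b - m%:~R * a) =
    if (j < N)%N then test (t + j%:R * b) else 0.
  set x := t + j%:R * b.
  have -> : test x * chi0c c (x - m%:~R * a) = test x * chi0c (N%:R * b) (x - m%:~R * a).
    rewrite testE; have [ont|] := boolP (on x); last by rewrite mulr0 !mul0r.
    have [h|] := boolP (cb (fl x) || cb (fl x - r%:Z)).
      rewrite (@window_eq (fl x))//; last exact/slotE.
      by case/orP: h => /and3P[_ _ d]; [left|right].
    by rewrite negb_or => /andP[/negPf -> /negPf ->]; rewrite subrr !mul0r.
  have jb0 : 0 <= j%:R * b by rewrite mulr_ge0 ?ler0n ?ltW.
  rewrite /chi0c /x; have -> /= : 0 <= t + j%:R * b - m%:~R * a by lra.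
  case: (ltnP j N) => jN.
    have : j.+1%:R * b <= N%:R * b by rewrite ler_pM2r// ler_nat.
    rewrite -addn1 natrD mulrDl mul1r => h.
    have -> : t + j%:R * b - m%:~R * a < N%:R * b by lra.
    by rewrite mulr1.
  have : N%:R * b <= j%:R * b by rewrite ler_pM2r// ler_nat.
  move=> h; have -> : (t + j%:R * b - m%:~R * a < N%:R * b) = false by apply/negbTE; rewrite -leNgt; lra.
  by rewrite mulr0.
transitivity (\sum_(j < K) (if (j < N)%N then test (t + j%:R * b) else 0)).
  by apply: eq_bigr => j _; exact: E.
rewrite -(big_mkord xpredT (fun j => if (j < N)%N then test (t + j%:R * b) else 0)).
rewrite (@big_cat_nat _ _ _ N 0 K)//= [X in _ + X]big_nat_cond [X in _ + X]big1 ?addr0; last first.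
  by move=> j /andP[/andP[h _] _]; rewrite ltnNge h.
rewrite big_mkord; apply: eq_bigr => j _; by rewrite ltn_ord.
Qed.

Definition wsum (t : R) : R := \sum_(j < N) test (t + j%:R * b).

(** By [comb_window] the window sum is a difference of indicators of two index intervals, shifted by
    [r] from each other. It can be nonzero only on [r < N] indices at each end, which the two
    families of [N] slots in [ub] cover; the bound is independent of [J]. *)
Lemma wsum_upper : (\int[mu]_t ((wsum t) ^+ 2)%:E <= (2 * N%:R * delta)%:E)%E.
Proof.
pose M := (J * N)%:Z - N%:Z.
pose ub t : \bar R := (\sum_(i < N) ((\1_(slot (- N%:Z + 1 + (i : nat)%:Z)) t)%:E +
    (\1_(slot (M + 1 + (i : nat)%:Z)) t)%:E))%E.
have mi := mslot.
have i0 l t : (0 <= (\1_(slot l) t)%:E :> \bar R)%E by rewrite lee_fin.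
have -> : ((2 * N%:R * delta)%:E = \int[mu]_t ub t)%E.
  rewrite ge0_integral_sum//; last first.
  - by move=> i t _; apply: adde_ge0; exact: i0.
  - by move=> i; apply: emeasurable_funD; exact: mi.
  rewrite (eq_bigr (fun=> (2 * delta)%:E)).
    by rewrite sume_cst ?lee_fin ?mulr_ge0 ?ltW// -EFinM; congr EFin; ring.
  move=> i _; transitivity (delta%:E + delta%:E)%E; last by rewrite -EFinD; congr EFin; ring.
  rewrite ge0_integralD; try exact: mi; try exact: measurableT; try by move=> t _; exact: i0.
  by congr (_ + _)%E; exact: integral_slot.
have mw : measurable_fun setT wsum.
  apply: measurable_sum => j; apply: (measurableT_comp (f := test)); last exact: measurable_shift.
  by have [] := sqint_test.
apply: ge0_le_integral => //.
- by move=> t _; rewrite lee_fin sqr_ge0.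
- exact: measurable_sqr.
- by apply: emeasurable_sum => i; apply: emeasurable_funD; exact: mi.
move=> t _; rewrite /ub /wsum.
under eq_bigr => j _.
  rewrite testE; have [-> ->] := fl_shift t j.
  rewrite (_ : fl t + j%:Z - r%:Z = fl t - r%:Z + j%:Z); last by ring.
  over.
have N0 : (0 < N)%N by exact: leq_ltn_trans r_lt.
rewrite -mulr_suml sumrB !comb_window//.
under [leRHS]eq_bigr do rewrite -EFinD !indic_slot.
rewrite sumEFin lee_fin.
have [ont|_] := boolP (on t); last first.
  by rewrite mulr0 expr0n/= sumr_ge0// => i _; rewrite addr_ge0.
under eq_bigr do rewrite !andbT.
rewrite mulr1 -/M; set f := fl t; set A := (_ && _); set B := (_ && _).
have [e|ne] := eqVneq A B.
  by rewrite e subrr expr0n/= sumr_ge0// => i _; rewrite addr_ge0.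
have le1 : (A%:R - B%:R) ^+ 2 <= 1 :> R by case: (A) (B) => -[]; rewrite ?subrr ?subr0 ?sub0r ?sqrrN ?expr1n ?expr0n.
apply: (le_trans le1).
have [fl0|fl1] : (- N%:Z < f < 0) \/ (M < f <= M + r%:Z).
  by move: ne; rewrite /A /B; case: (ltP (- N%:Z) f); case: (leP f M);
    case: (ltP (- N%:Z) (f - r%:Z)); case: (leP (f - r%:Z) M) => /=; lia.
- have iN : (`|(f + N%:Z - 1)%R| < N)%N by lia.
  rewrite (bigD1 (Ordinal iN))//= (_ : (_ == f) = true) ?addrA; last by apply/eqP; lia.
  by rewrite -addrA lerDl addr_ge0// sumr_ge0// => i _; rewrite addr_ge0.
- have iN : (`|(f - M - 1)%R| < N)%N by lia.
  rewrite (bigD1 (Ordinal iN))//= [X in (_ + (nat_of_bool X)%:R) + _](_ : _ = true); last by apply/eqP; lia.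
  by rewrite -addrA addrCA lerDl addr_ge0// sumr_ge0// => i _; rewrite addr_ge0.
Qed.

Lemma energy_test_upper (Q : nat) : b <= Q%:R * a ->
  (\esum_(m in [set: int]) energy a b c K test m <= (Q%:R * (2 * N%:R * delta))%:E)%E.
Proof.
move=> bQ.
have mw : measurable_fun setT wsum.
  apply: measurable_sum => j; apply: (measurableT_comp (f := test)); last exact: measurable_shift.
  by have [] := sqint_test.
have w0 t : (0 <= ((wsum t) ^+ 2)%:E)%E by rewrite lee_fin sqr_ge0.
have h := esum_overlap_le a_gt0 bQ (measurable_sqr mw) w0.
apply: le_trans (le_trans h _).
- apply: le_esum => m _; rewrite le_eqVlt; apply/orP; left; apply/eqP.
  by apply: eq_integral => t; rewrite inE => tm; rewrite per_test.
- by rewrite EFinM; apply: lee_wpmul2l; rewrite ?lee_fin ?ler0n//; exact: wsum_upper.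
Qed.

End Test.

Lemma not_frame : ~ gabor_frame (chi0c c) (fun=> 0) a b.
Proof.
move=> /(lower_of_frame b_gt0 c_le)[A A0 lo].
pose Q := (Num.truncn (b / a)).+1.
have bQ : b <= Q%:R * a by rewrite -ler_pdivrMr// ltW// truncnS_gt.
(* [J > X] makes [A * J * delta] exceed the energy bound [Q * 2 N delta]. *)
pose X : R := Q%:R * (2 * N%:R) / A.
pose J := (Num.truncn X).+1.
have := le_trans (lo _ (sqint_test J)) (energy_test_upper J bQ).
move=> h; have := le_trans (lee_wpmul2l (ltW _ : (0 <= A%:E)%E) (test_lower J)) h.
rewrite lte_fin -EFinM lee_fin => /(_ A0).
rewrite !mulrA ler_pM2r// -ler_pdivlMl// mulrC.
have : X < J%:R by exact: truncnS_gt.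
rewrite /X mulrA => h1 h2.
by have := lt_le_trans h1 h2; rewrite ltxx.
Qed.

End NotFrame.

(** * Translation orbits modulo [a] *)

Section Orbits.
Variables (R : realType) (a b be ep : R) (N : nat).
Hypotheses (a_gt0 : 0 < a) (b_gt0 : 0 < b) (ep_gt0 : 0 < ep) (N_gt0 : (0 < N)%N).

(* [be = - ep] in case (VI) and [be = 0] in case (VII). *)
Definition bad (t : R) : Prop := exists m : int, be <= t - m%:~R * a < be + ep.

Local Notation D := (N%:R * b).
Local Notation hit L := (hit b N L bad).

(** Dirichlet's pigeonhole argument: among the [P + 1] fractional parts [y i], two share one of [P]
    boxes of length [1 / P], and [a / P < ep]. The hypothesis excludes an exact return. *)
Lemma small_return : (forall (s : nat) (z : int), (0 < s)%N -> s%:R * D != z%:~R * a) ->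
  exists (s : nat) (z : int), (0 < s)%N /\ 0 < `|s%:R * D - z%:~R * a| < ep.
Proof.
move=> irr; pose P := (Num.truncn (a / ep)).+1.
have P0 : (0 : R) < P%:R by rewrite ltr0n.
have aP : a < P%:R * ep by rewrite -ltr_pdivrMr// truncnS_gt.
pose y (i : nat) : R := i%:R * D / a - (Num.floor (i%:R * D / a))%:~R.
have y01 i : 0 <= y i < 1.
  have /andP[h1 h2] := floor_itv (i%:R * D / a).
  by rewrite /y subr_ge0 h1 /= ltrBlDl; move: h2; rewrite intrD.
have bk (i : 'I_P.+1) : (Num.truncn (P%:R * y i) < P)%N.
  have /andP[h1 h2] := y01 i.
  have h0 : 0 <= P%:R * y i by rewrite mulr_ge0// ltW.
  have /andP[h3 h4] := truncn_itv h0.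
  by rewrite -(ltr_nat R); apply: (le_lt_trans h3); rewrite -[ltRHS]mulr1 ltr_pM2l.
pose f (i : 'I_P.+1) : 'I_P := Ordinal (bk i).
have [i [j [ij fij]]] : exists i j : 'I_P.+1, (i < j)%N /\ f i = f j.
  have /injectivePn [i [j ij fij]] : ~~ injectiveb f.
    apply/negP => /injectiveP fi; have := leq_card f fi.
    by rewrite !card_ord ltnn.
  case: (ltngtP i j) => h; [by exists i, j|by exists j, i|].
  by move/eqP: ij; case; exact: val_inj.
exists (j - i)%N, (Num.floor (j%:R * D / a) - Num.floor (i%:R * D / a)).
split; first by lia.
have e : (j - i)%N%:R * D - (Num.floor (j%:R * D / a) - Num.floor (i%:R * D / a))%:~R * a
    = (y j - y i) * a.
  rewrite natrB ?(ltnW ij)// intrB /y; field; by rewrite gt_eqF.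
rewrite normr_gt0 subr_eq0 irr /=; last by lia.
rewrite e normrM (gtr0_norm a_gt0) mulrC -ltr_pdivlMl//.
have d1 : `|P%:R * y j - P%:R * y i| < 1.
  have h0 (l : 'I_P.+1) : 0 <= P%:R * y l.
    by have /andP[h _] := y01 l; rewrite mulr_ge0// ltW.
  have /andP[h1 h2] := truncn_itv (h0 i); have /andP[h3 h4] := truncn_itv (h0 j).
  have ft : Num.truncn (P%:R * y i) = Num.truncn (P%:R * y j) by case: fij.
  move: h1 h2 h3 h4; rewrite ft; move: (Num.truncn (P%:R * y j)) => T.
  rewrite -(addn1 T) natrD => h1 h2 h3 h4.
  by rewrite ltr_norml; apply/andP; split; lra.
move: d1; rewrite -mulrBr normrM (gtr0_norm P0) mulrC -ltr_pdivlMr// mul1r => d1.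
apply: (lt_trans d1); rewrite -ltr_pdivrMl ?invr_gt0// invrK.
by rewrite mulrC ltr_pdivrMr// in aP *; rewrite mulrC -ltr_pdivrMr.
Qed.

(** Steps of size [|eta|], shorter than the bad interval, cannot jump over it. About [a / |eta|] of
    them, each made of [s] translations, sweep a full period. *)
Lemma hits_of_small_return (s : nat) (z : int) : (0 < s)%N ->
  0 < `|s%:R * D - z%:~R * a| < ep -> exists2 L : nat, (0 < L)%N & forall t, hit L t.
Proof.
move=> s0; set eta := s%:R * D - z%:~R * a => /andP[n0 nep].
pose J := (Num.truncn (a / `|eta|)).+1.
exists (J * s).+1 => // t.
pose m := Num.floor ((t - be) / a); pose y := t - be - m%:~R * a.
have /andP[y0 ya] : 0 <= y < a.
  have := tile_floor a_gt0 (t - be); rewrite /tile /= in_itv/= -/m => /andP[h1 h2].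
  rewrite /y subr_ge0 h1 /= ltrBlDl; move: h2; rewrite intrD mulrDl mul1r; lra.
have key (j : nat) (m' : int) : (j <= J)%N -> 0 <= y + j%:R * eta - m'%:~R * a < ep ->
    hit (J * s).+1 t.
  move=> jJ /andP[h1 h2]; exists (j * s)%N; first by rewrite ltnS leq_mul2r jJ orbT.
  exists (m + m' + j%:Z * z); rewrite !intrD intrM natrM.
  have -> : t + j%:R * s%:R * D - (m%:~R + m'%:~R + j%:R * z%:~R) * a =
     be + (y + j%:R * eta - m'%:~R * a) by rewrite /y /eta; ring.
  by rewrite lerDl h1 /= ltrD2l.
(* A negative [eta] leads down to the bad interval of the current period ([m' = 0]), a positive one
   past the end of this period into the next bad interval ([m' = 1]). *)
have [eta0|eta0|e0] := ltrgtP eta 0; last by rewrite e0 normr0 ltxx in n0.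
- have ne : `|eta| = - eta by rewrite ltr0_norm.
  have q0 : 0 <= y / `|eta| by rewrite divr_ge0.
  have /andP[h1 h2] := truncn_itv q0; set j := Num.truncn _ in h1 h2.
  apply: (key j 0).
    rewrite -ltnS -(ltr_nat R); apply: (le_lt_trans h1).
    apply: (lt_trans (y := a / `|eta|)); first by rewrite ltr_pM2r ?invr_gt0.
    by apply: (lt_trans (truncnS_gt _)); rewrite ltr_nat.
  move: h1 h2; rewrite ler_pdivlMr// ltr_pdivrMr// -addn1 natrD mulrDl mul1r ne mul0r => h1 h2.
  by rewrite ne in nep; apply/andP; split; lra.
- have ne : `|eta| = eta by rewrite gtr0_norm.
  have q0 : 0 <= (a - y) / `|eta| by rewrite divr_ge0// subr_ge0 ltW.
  have /andP[h1 h2] := truncn_itv q0; set j := Num.truncn _ in h1 h2.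
  apply: (key j.+1 1).
    rewrite /J ltnS; apply: le_truncn; rewrite ler_pM2r ?invr_gt0//; lra.
  move: h1 h2; rewrite ler_pdivlMr// ltr_pdivrMr// -addn1 natrD !mulrDl !mul1r ne => h1 h2.
  by rewrite ne in nep; apply/andP; split; lra.
Qed.

Section Rational.
Variables p q : nat.
Hypotheses (p_gt0 : (0 < p)%N) (q_gt0 : (0 < q)%N) (cop : coprime p q).
Variable w : R.
Hypotheses (aw : a = p%:R * w) (bw : b = q%:R * w).
Local Notation d := (gcdn N p).
Local Notation gap := (d%:R * w).

Lemma w_gt0 : 0 < w.
Proof. by move: a_gt0; rewrite aw pmulr_rgt0// ltr0n. Qed.

Lemma d_gt0 : (0 < d)%N. Proof. by rewrite gcdn_gt0 N_gt0. Qed.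

Lemma gap_gt0 : 0 < gap. Proof. by rewrite mulr_gt0 ?w_gt0 ?ltr0n ?d_gt0. Qed.

(** Coprimality gives [gcd(N q, p) = d], so by Bezout [d w] is an integer combination of
    [N b = N q w] and [a = p w]. Translation by [- x d w] is thus, modulo [a], translation by
    [j N b]; [j] may be reduced modulo [p] because [p * (N b)] is a multiple of [a]. *)
Lemma hit_gap t (x : int) : be <= t - x%:~R * gap < be + ep -> hit p t.
Proof.
move=> ht.
have gE : gcdn (N * q) p = d by rewrite gcdnC Gauss_gcdl// gcdnC.
have [uu [vv uvE]] : exists uu vv : int, uu * (N * q)%:Z + vv * p%:Z = d%:Z.
  have [uu [vv e]] := Bezoutz (N * q)%:Z p%:Z.
  by exists uu, vv; rewrite e /gcdz /= gE.
pose j := ((- x * uu) %% p%:Z)%Z; pose e := ((- x * uu) %/ p%:Z)%Z.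
have je : - x * uu = e * p%:Z + j by exact: divz_eq.
have j0 : 0 <= j by apply: modz_ge0; lia.
have jp : j < p%:Z by apply: ltz_pmod; lia.
exists `|j|%N; first by lia.
exists (x * vv - e * (N * q)%:Z).
have jZ : (`|j|%N%:Z : int) = j by rewrite gez0_abs.
have xd : x * d%:Z = (x * vv - e * (N * q)%:Z) * p%:Z - j * (N * q)%:Z.
  have -> : j = - x * uu - e * p%:Z by rewrite je; ring.
  by rewrite -uvE; ring.
have xdR : x%:~R * d%:R = (x * vv - e * (N * q)%:Z)%:~R * p%:R - `|j|%N%:R * (N%:R * q%:R) :> R.
  have := congr1 (fun i : int => i%:~R : R) xd.
  by rewrite intrB !intrM -jZ PoszM !intrM.
move: ht; rewrite (mulrA x%:~R) xdR bw aw => /andP[h1 h2].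
by apply/andP; split; [apply: le_trans h1 _|apply: le_lt_trans _ h2];
   rewrite le_eqVlt; apply/orP; left; apply/eqP; ring.
Qed.

Lemma gap_residue t : exists x : int, be <= t - x%:~R * gap < be + gap.
Proof.
have := tile_floor gap_gt0 (t - be); rewrite /tile /= in_itv/=; set x := Num.floor _.
move=> /andP[h1 h2]; exists x; move: h2; rewrite intrD mulrDl mul1r => h2.
by apply/andP; split; lra.
Qed.

Lemma hits_gap_le t : gap <= ep -> hit p t.
Proof.
move=> ge; have [x /andP[h1 h2]] := gap_residue t; apply: (@hit_gap t x).
by rewrite h1 /=; lra.
Qed.

(** As [N] divides [p], it is prime to [q], and [r * q] has a nonzero residue [i] modulo [N]. If [t]
    is missed, its residue lies in the last [w] of the spacing [N w]; adding [i w] wraps it around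
    into the first [(N - 1) w], which the bad interval covers. *)
Lemma hits_gap_one t : d = N -> N%:R * w - w <= ep ->
  hit p t \/ forall r : nat, (0 < r < N)%N -> hit p (t + r%:R * b).
Proof.
move=> dN ge; have w0 := w_gt0; have [x /andP[h1 h2]] := gap_residue t.
have [le|le] := ltP (t - x%:~R * gap) (be + ep).
  by left; apply: (@hit_gap t x); rewrite h1.
right => r /andP[r0 rN].
have Np : (N %| p)%N by rewrite -dN dvdn_gcdr.
have cNq : coprime N q by apply: coprime_dvdl cop.
pose i := (r * q %% N)%N; pose e := (r * q %/ N)%N.
have rq : (r * q = e * N + i)%N by exact: divn_eq.
have iN : (i < N)%N by rewrite ltn_mod.
have i0 : (0 < i)%N.
  rewrite lt0n; apply/negP => /eqP iz.
  have : (N %| r * q)%N by rewrite /dvdn -/i iz.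
  by rewrite Gauss_dvdl// => /(dvdn_leq r0); rewrite leqNgt rN.
apply: (@hit_gap _ (x + e%:Z + 1)).
have rqR : r%:R * q%:R = e%:R * N%:R + i%:R :> R by rewrite -!natrM rq natrD natrM.
have i1 : w <= i%:R * w by rewrite -{1}[w]mul1r ler_pM2r// ler1n.
have i2 : i%:R * w <= N%:R * w - w.
  have : (i + 1)%:R * w <= N%:R * w by rewrite ler_pM2r// ler_nat addn1.
  by rewrite natrD mulrDl mul1r; lra.
rewrite dN in h1 h2 le *.
have -> : t + r%:R * b - (x + e%:Z + 1)%:~R * (N%:R * w) =
    (t - x%:~R * (N%:R * w)) + i%:R * w - N%:R * w.
  rewrite bw mulrA rqR !intrD; ring.
by apply/andP; split; lra.
Qed.

(** [a] is a multiple of the spacing; avoiding the bad interval modulo the spacing is therefore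
    enough to avoid the bad set. *)
Lemma bad_gap t : bad t -> exists x : int, be <= t - x%:~R * gap < be + ep.
Proof.
move=> [m hm]; have /dvdnP[p' pE] : (d %| p)%N by exact: dvdn_gcdr.
exists (m * p'%:Z); rewrite intrM.
have pR : p%:R = p'%:R * d%:R :> R by rewrite -natrM -pE.
by rewrite (_ : _ * gap = m%:~R * a)// aw pR; ring.
Qed.

End Rational.
End Orbits.

(** * Frame characterization from the abstract window properties *)

Section Core.
Variables (R : realType) (a b c be ep : R) (N K : nat).
Hypotheses (a_gt0 : 0 < a) (ab : a < b) (c_le : c <= K%:R * b).
Hypotheses (ep_gt0 : 0 < ep) (N_gt0 : (0 < N)%N) (NK : (N <= K)%N).
Local Notation bad := (bad a be ep).
Local Notation per := (periodize a b c K).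

Hypothesis per_bad : forall (u : R -> R) m t, tile a m t -> bad t ->
  per u m t - per u (m + 1) (t + b) = u t.
Hypothesis per_good : forall (u : R -> R) m t, tile a m t -> ~ bad t ->
  per u m t - per u (m + 1) (t + b) = u t - u (t + N%:R * b).
Hypothesis per_sum : forall (u : R -> R) m t, tile a m t -> ~ bad t ->
  per u m t = \sum_(j < N) u (t + j%:R * b).
Hypothesis window_good : forall (m : int) t, ~ bad (t - N%:R * b) ->
  chi0c c (t - m%:~R * a) = chi0c (N%:R * b) (t - m%:~R * a).

Let b_gt0 : 0 < b. Proof. exact: lt_trans ab. Qed.

Lemma frame_irrational :
  ~ (exists p q : nat, [/\ (0 < p)%N, (0 < q)%N, coprime p q & a / b = p%:R / q%:R]) ->
  gabor_frame (chi0c c) (fun=> 0) a b.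
Proof.
move=> irr.
have [s [z [s0 hz]]] : exists (s : nat) (z : int), (0 < s)%N /\
    0 < `|s%:R * (N%:R * b) - z%:~R * a| < ep.
  (* A relation [s N b = z a] would give [a / b = s N / z]; division by the gcd produces the coprime
     [p] and [q]. *)
  apply: small_return => // s z s0; apply/negP => /eqP E; apply: irr.
  have sNb : 0 < s%:R * (N%:R * b) by rewrite !mulr_gt0 ?ltr0n.
  have z0 : 0 < z by move: sNb; rewrite E pmulr_lgt0// ltr0z.
  pose n := `|z|%N; have nz : z = n%:Z by rewrite /n gtz0_abs.
  have n0 : (0 < n)%N by lia.
  pose g := gcdn (s * N) n.
  have g0 : (0 < g)%N by rewrite gcdn_gt0 n0 orbT.
  have /dvdnP[p Hp] : (g %| s * N)%N by exact: dvdn_gcdl.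
  have /dvdnP[q Hq] : (g %| n)%N by exact: dvdn_gcdr.
  have p0 : (0 < p)%N.
    by move: (muln_gt0 s N); rewrite s0 N_gt0 /= Hp muln_gt0 => /andP[].
  have q0 : (0 < q)%N by move: n0; rewrite Hq muln_gt0 => /andP[].
  exists p, q; split => //.
    rewrite /coprime; have : gcdn (p * g) (q * g) == g by rewrite -Hp -Hq.
    by rewrite -muln_gcdl -{2}(mul1n g) eqn_pmul2r.
  have nR : n%:R = q%:R * g%:R :> R by rewrite -natrM -Hq.
  have sR : s%:R * N%:R = p%:R * g%:R :> R by rewrite -!natrM -Hp.
  have gR : (g%:R : R) != 0 by rewrite pnatr_eq0 -lt0n.
  have qR : (q%:R : R) != 0 by rewrite pnatr_eq0 -lt0n.
  have -> : a = p%:R * g%:R * b / (q%:R * g%:R).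
    apply: (@mulIf _ (q%:R * g%:R)); first by rewrite mulf_neq0.
    rewrite mulfVK ?mulf_neq0// -sR -mulrA E nz -nR mulrC.
    by [].
  by field; rewrite gR qR gt_eqF.
have [L L0 hL] := hits_of_small_return be a_gt0 s0 hz.
apply: (@frame_of_hits R a b c K a_gt0 (ltW ab) N L bad) => // t.
by left; exact: hL.
Qed.

Section RationalCase.
Variables (p q : nat).
Hypotheses (p_gt0 : (0 < p)%N) (q_gt0 : (0 < q)%N) (cop : coprime p q).
Hypothesis abE : a / b = p%:R / q%:R.
Local Notation d := (gcdn N p).
Let w := b / q%:R.

Let bw : b = q%:R * w.
Proof. by rewrite mulrC mulfVK// gt_eqF ?ltr0n. Qed.

Let aw : a = p%:R * w.
Proof.
have : a = a / b * b by rewrite mulfVK ?gt_eqF.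
by rewrite abE /w => ->; ring.
Qed.

Lemma frame_rational : (d%:R * w <= ep) \/ (d = N /\ d%:R * w - w <= ep) ->
  gabor_frame (chi0c c) (fun=> 0) a b.
Proof.
move=> h; apply: (@frame_of_hits R a b c K a_gt0 (ltW ab) N p bad) => // t.
case: h => [h|[dN h]].
  by left; exact: (hits_gap_le be a_gt0 b_gt0 ep_gt0 N_gt0 p_gt0 q_gt0 cop aw bw).
by apply: (hits_gap_one be a_gt0 b_gt0 ep_gt0 N_gt0 p_gt0 q_gt0 cop aw bw) => //; rewrite dN in h.
Qed.

(** Since [N b] is a multiple of the spacing [d w], all slots used have offset 0 or [sg] modulo
    [d w]. Between consecutive bad intervals there is a free interval of length [d w - ep], starting
    at [be + ep]; shortening it by [sg] leaves a slot whose translate by [sg] is free as well. *)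
Lemma not_frame_residue (r : nat) (x : int) (sg : R) : (0 < r < N)%N ->
  r%:R * b = x%:~R * (d%:R * w) + sg -> 0 <= sg -> ep + sg < d%:R * w ->
  ~ gabor_frame (chi0c c) (fun=> 0) a b.
Proof.
move=> /andP[r0 rN] rb sg0 esg.
have gap0 := gap_gt0 a_gt0 N_gt0 p_gt0 aw.
have w0 := w_gt0 a_gt0 p_gt0 aw.
have dp : d%:R * w <= p%:R * w by rewrite ler_pM2r// ler_nat dvdn_leq// dvdn_gcdr.
have [N' NE] : exists N' : nat, (N = N' * d)%N by apply/dvdnP; exact: dvdn_gcdl.
have NR : N%:R = N'%:R * d%:R :> R by rewrite -natrM -NE.
apply: (@not_frame R a b c K N r (be + ep) (d%:R * w - ep - sg)) => //.
- lra.
- have pb : p%:R * w < b by rewrite -aw.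
  by rewrite lerBlDr lerBlDr (le_trans dp)// (le_trans (ltW pb))// -addrA lerDl addr_ge0// ltW.
move=> l m t hl; rewrite /slot /= in_itv/= => /andP[t1 t2].
apply: window_good => /(bad_gap N aw)[X /andP[X1 X2]].
have [Y [sg' [sg'0 sg'1 lE]]] : exists (Y : int) (sg' : R),
    [/\ 0 <= sg', sg' <= sg & l%:~R * b - N%:R * b = Y%:~R * (d%:R * w) + sg'].
  have cR (y : int) : (y * (N' * q)%:Z - (N' * q)%:Z)%:~R =
      y%:~R * (N'%:R * q%:R) - N'%:R * q%:R :> R.
    by rewrite intrB intrM -pmulrn natrM.
  case: hl => /dvdzP[y Hy].
    exists (y * (N' * q)%:Z - (N' * q)%:Z), 0; split => //.
    have -> : l%:~R = y%:~R * N%:R :> R by rewrite Hy intrM.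
    by rewrite cR NR bw; ring.
  exists (y * (N' * q)%:Z - (N' * q)%:Z + x), sg; split => //.
  have -> : l%:~R = y%:~R * N%:R + r%:R :> R.
    by rewrite (_ : l = y * N%:Z + r%:Z) ?intrD ?intrM// -Hy subrK.
  by rewrite mulrDl rb intrD cR NR {1 2}bw; ring.
have [h|h] := leP X Y.
  have : X%:~R * (d%:R * w) <= Y%:~R * (d%:R * w) by rewrite ler_pM2r// ler_int.
  lra.
have : (Y + 1)%:~R * (d%:R * w) <= X%:~R * (d%:R * w) by rewrite ler_pM2r// ler_int lezD1.
by rewrite intrD mulrDl mul1r; lra.
Qed.

(** For [d < N] take [r = d]: the offset is 0 because [d b = q (d w)]. For [d = N] the offsets are
    nonzero multiples of [w], and the smallest one is reached by the inverse [r] of [q] modulo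
    [N]. *)
Lemma not_frame_rational :
  (ep < d%:R * w /\ d <> N) \/ (ep < d%:R * w - w /\ d = N) ->
  ~ gabor_frame (chi0c c) (fun=> 0) a b.
Proof.
case=> [[h dN]|[h dN]].
  have dlt : (0 < d < N)%N.
    rewrite gcdn_gt0 N_gt0 /= ltn_neqAle dvdn_leq ?dvdn_gcdl// andbT.
    exact/eqP.
  apply: (@not_frame_residue d q%:Z 0) => //; last by rewrite addr0.
  by rewrite bw; ring.
have w0 := w_gt0 a_gt0 p_gt0 aw.
(* For [N = 1] the hypothesis [h] would read [ep < 0]. *)
have N1 : (1 < N)%N.
  rewrite ltnNge; apply/negP => N1; have N1e : N = 1%N by lia.
  by move: h; rewrite dN N1e mul1r subrr ltNge (ltW ep_gt0).
have Np : (N %| p)%N by rewrite -dN dvdn_gcdr.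
have cNq : coprime N q by apply: coprime_dvdl cop.
have [r [e [rlt rq]]] : exists r e : nat, (0 < r < N)%N /\ (r * q = e * N + 1)%N.
  have cqN : coprime q N by rewrite coprime_sym.
  have [u uE] : exists u : nat, (u * q = 1 %[mod N])%N.
    case: (egcdnP N q_gt0) => km kn E _.
    exists km; rewrite E (eqP cqN : gcdn q N = 1%N).
    by rewrite modnMDl.
  exists (u %% N)%N, ((u %% N) * q %/ N)%N.
  have E : ((u %% N) * q %% N = 1)%N by rewrite modnMml uE modn_small.
  split; last by rewrite [LHS](divn_eq _ N) E.
  rewrite ltn_mod N_gt0 andbT lt0n; apply/negP => /eqP u0.
  by move: E; rewrite u0 mul0n mod0n.
apply: (@not_frame_residue r e%:Z w) => //.
- rewrite dN {1}bw mulrA -natrM rq natrD natrM; ring.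
- exact: ltW.
- lra.
Qed.

End RationalCase.

Lemma not_frame_iff : ~ gabor_frame (chi0c c) (fun=> 0) a b <->
  exists p q : nat, [/\ (0 < p)%N, (0 < q)%N, coprime p q, a / b = p%:R / q%:R &
    (ep < (gcdn N p)%:R * (b / q%:R) /\ gcdn N p <> N) \/
    (ep < (gcdn N p)%:R * (b / q%:R) - b / q%:R /\ gcdn N p = N)].
Proof.
split; last by move=> [p [q [p0 q0 cop E h]]]; exact: (not_frame_rational p0 q0 cop E h).
move=> nf; apply: contrapT => nex; apply: nf.
have [[p [q [p0 q0 cop E]]]|] := pselect (exists p q : nat,
    [/\ (0 < p)%N, (0 < q)%N, coprime p q & a / b = p%:R / q%:R]); last first.
  exact: frame_irrational.
apply: (frame_rational p0 q0 cop E).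
have [dN|dN] := pselect (gcdn N p = N).
  right; split => //; rewrite leNgt; apply/negP => h; apply: nex.
  by exists p, q; split => //; right.
left; rewrite leNgt; apply/negP => h; apply: nex.
by exists p, q; split => //; left.
Qed.

End Core.

(** * The two cases *)

Section Windows.
Variables (R : realType) (a b c0 : R) (k : nat).
Hypotheses (a_gt0 : 0 < a) (ab : a < b) (c0_ge0 : 0 <= c0) (c0_lt : c0 < b).
Local Notation c := (k%:R * b + c0).
Local Notation per := (periodize a b c k.+1).
Variables (u : R -> R) (m : int) (t : R).
Hypothesis tm : tile a m t.
Local Notation y := (t - m%:~R * a).

Let b_gt0 : 0 < b. Proof. exact: lt_trans ab. Qed.

Let y_itv : 0 <= y < a.
Proof.
move: tm; rewrite /tile /= in_itv/= intrD mulrDl mul1r => /andP[h1 h2].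
by apply/andP; split; lra.
Qed.

Let jbk (j : nat) : (j < k)%N -> 0 <= j%:R * b /\ j%:R * b + b <= k%:R * b.
Proof.
move=> jk; split; first by rewrite mulr_ge0 ?ler0n// ltW.
have : (j + 1)%:R * b <= k%:R * b by rewrite ler_pM2r// ler_nat addn1.
by rewrite natrD mulrDl mul1r.
Qed.

Let kb0 : 0 <= k%:R * b. Proof. by rewrite mulr_ge0 ?ler0n// ltW. Qed.

(** On a tile [0 <= y < a < b], so the first [k] points always lie in the window and only the last
    one depends on [y]. *)
Lemma per_tile : per u m t = \sum_(j < k) u (t + j%:R * b) + (y < c0)%R%:R * u (t + k%:R * b).
Proof.
have /andP[y0 ya] := y_itv; have h1 := ab; have h2 := c0_ge0; have h3 := kb0; have h4 := b_gt0.
rewrite /periodize big_ord_recr/=; congr (_ + _).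
  apply: eq_bigr => j _; have [j0 jk] := jbk (ltn_ord j).
  rewrite /chi0c (_ : (_ <= _) && (_ < _) = true) ?mulr1//.
  by apply/andP; split; lra.
rewrite mulrC /chi0c; have -> /= : 0 <= t + k%:R * b - m%:~R * a by lra.
have -> : (t + k%:R * b - m%:~R * a < c) = (y < c0) by apply/idP/idP => h; lra.
by case: (y < c0).
Qed.

Lemma per_tile_next : per u (m + 1) (t + b) =
  \sum_(j < k) u (t + j.+1%:R * b) + (y + b - a < c0)%R%:R * u (t + k.+1%:R * b).
Proof.
have /andP[y0 ya] := y_itv; have h1 := ab; have h2 := c0_ge0; have h3 := kb0; have h4 := b_gt0.
rewrite /periodize big_ord_recr/=.
have mE : (m + 1)%:~R * a = m%:~R * a + a by rewrite intrD mulrDl mul1r.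
have jE (j : nat) : t + b + j%:R * b = t + j.+1%:R * b by rewrite -natr1; ring.
rewrite !mE; congr (_ + _).
  apply: eq_bigr => j _; have [j0 jk] := jbk (ltn_ord j).
  rewrite -jE /chi0c (_ : (_ <= _) && (_ < _) = true) ?mulr1//.
  by apply/andP; split; lra.
rewrite mulrC -jE /chi0c; have -> /= : 0 <= t + b + k%:R * b - (m%:~R * a + a) by lra.
have -> : (t + b + k%:R * b - (m%:~R * a + a) < c) = (y + b - a < c0) by apply/idP/idP => h; lra.
by case: (y + b - a < c0).
Qed.

Lemma per_diff : per u m t - per u (m + 1) (t + b) =
  u t - u (t + k%:R * b) + (y < c0)%R%:R * u (t + k%:R * b)
  - (y + b - a < c0)%R%:R * u (t + k.+1%:R * b).
Proof.
rewrite per_tile per_tile_next.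
have : \sum_(j < k) u (t + j%:R * b) - \sum_(j < k) u (t + j.+1%:R * b) = u t - u (t + k%:R * b).
  rewrite -sumrB -(big_mkord xpredT (fun j => u (t + j%:R * b) - u (t + j.+1%:R * b))).
  rewrite (eq_bigr (fun j => - (u (t + j.+1%:R * b) - u (t + j%:R * b)))); last by move=> j _; rewrite opprB.
  by rewrite sumrN telescope_sumr// mul0r addr0 opprB.
lra.
Qed.

End Windows.

Section Cases.
Variables (R : realType) (a b c : R).
Hypotheses (a_gt0 : 0 < a) (ab : a < b) (bc : b < c).
Let k := Num.truncn (c / b).
Let c0 := c - k%:R * b.

Let b_gt0 : 0 < b. Proof. exact: lt_trans ab. Qed.

Let cE : c = k%:R * b + c0. Proof. by rewrite /c0; ring. Qed.

Let c0_itv : 0 <= c0 < b.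
Proof.
have cb : 0 <= c / b by rewrite divr_ge0 ?(ltW b_gt0)// ltW// (lt_trans b_gt0).
have /andP[h1 h2] := truncn_itv cb; rewrite -/k in h1 h2.
move: h1 h2; rewrite ler_pdivlMr// ltr_pdivrMr// -natr1 mulrDl mul1r => h1 h2.
by rewrite /c0; apply/andP; split; lra.
Qed.

Let k_gt0 : (0 < k)%N.
Proof. by rewrite truncn_gt0 ler_pdivlMr// mul1r ltW. Qed.

Let c_le : c <= k.+1%:R * b.
Proof. by have /andP[_ h] := c0_itv; rewrite -natr1 mulrDl mul1r [leLHS]cE lerD2l ltW. Qed.

(** As [a <= c0], the test [y < c0] always succeeds on a tile, and only the last point of the next
    window varies. It drops out when [y + b - a >= c0], that is, when [t] lies within [b - c0] to
    the left of [(m + 1) a]; hence [be = - (b - c0)]. From [b - a < c0] this stretch is shorter than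
    a tile. *)
Lemma case_VI : a <= c0 -> b - a < c0 ->
  ~ gabor_frame (chi0c c) (fun=> 0) a b <->
  exists p q : nat, [/\ (0 < p)%N, (0 < q)%N, coprime p q, a / b = p%:R / q%:R &
    (b - c0 < (gcdn k.+1 p)%:R * (b / q%:R) /\ gcdn k.+1 p <> k.+1) \/
    (b - c0 < (gcdn k.+1 p)%:R * (b / q%:R) - b / q%:R /\ gcdn k.+1 p = k.+1)].
Proof.
move=> ac bac; have /andP[c00 c0b] := c0_itv; have h_a := a_gt0; have h_ab := ab.
have badE m t : tile a m t -> bad a (- (b - c0)) (b - c0) t <-> ~~ (t - m%:~R * a + b - a < c0).
  rewrite /tile /= in_itv/= intrD mulrDl mul1r => /andP[t1 t2]; rewrite -leNgt; split.
    move=> [m' /andP[h1 h2]]; have [h|h] := leP m' m.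
      have : m'%:~R * a <= m%:~R * a by rewrite ler_pM2r// ler_int.
      lra.
    have [h'|h'] := leP m' (m + 1); last first.
      have : (m + 1 + 1)%:~R * a <= m'%:~R * a by rewrite ler_pM2r// ler_int lezD1.
      by rewrite !intrD !mulrDl !mul1r; lra.
    have e : m' = m + 1 by apply/eqP; rewrite eq_le h' lezD1.
    by move: h1 h2; rewrite e intrD mulrDl mul1r; lra.
  by move=> h; exists (m + 1); rewrite intrD mulrDl mul1r; apply/andP; split; lra.
have yc0 m t : tile a m t -> (t - m%:~R * a < c0).
  by rewrite /tile /= in_itv/= intrD mulrDl mul1r => /andP[t1 t2]; lra.
apply: (@not_frame_iff R a b c (- (b - c0)) (b - c0) k.+1 k.+1) => //; first by lra.
- move=> u m t tm /(badE m t tm) B; rewrite cE per_diff// (yc0 _ _ tm) (negPf B).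
  by rewrite mul1r mul0r subr0 subrK.
- move=> u m t tm nB; have B : t - m%:~R * a + b - a < c0.
    by apply: contrapT => /negP h; apply: nB; exact/(badE m t tm).
  by rewrite cE per_diff// (yc0 _ _ tm) B !mul1r subrK.
- move=> u m t tm _; rewrite cE per_tile// (yc0 _ _ tm) mul1r.
  by rewrite big_ord_recr.
(* The two indicators differ only for [c <= t - m a < (k + 1) b], which places [t - N b] in the bad
   interval ending at [m a]. *)
- move=> m t nB; rewrite /chi0c; congr (if _ then _ else _); congr (_ && _).
  have e : k.+1%:R * b = c + (b - c0) by rewrite -natr1 mulrDl mul1r {1}cE; ring.
  rewrite e; apply/idP/idP => h; first by lra.
  rewrite ltNge; apply/negP => h2; apply: nB; exists m.
  by rewrite e; apply/andP; split; lra.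
Qed.

(** As [c0 <= b - a], the last point of the next window is never inside, and only [y < c0] varies:
    when it holds, the two terms at [t + k b] cancel and [u t] remains. *)
Lemma case_VII : 0 < c0 -> c0 < a -> c0 <= b - a ->
  ~ gabor_frame (chi0c c) (fun=> 0) a b <->
  exists p q : nat, [/\ (0 < p)%N, (0 < q)%N, coprime p q, a / b = p%:R / q%:R &
    (c0 < (gcdn k p)%:R * (b / q%:R) /\ gcdn k p <> k) \/
    (c0 < (gcdn k p)%:R * (b / q%:R) - b / q%:R /\ gcdn k p = k)].
Proof.
move=> c0p ca cba; have /andP[c00 c0b] := c0_itv; have h_a := a_gt0; have h_ab := ab.
have badE m t : tile a m t -> bad a 0 c0 t <-> (t - m%:~R * a < c0).
  rewrite /tile /= in_itv/= intrD mulrDl mul1r => /andP[t1 t2]; split.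
    move=> [m' /andP[h1 h2]]; have [h|h] := ltP m' m.
      have : (m' + 1)%:~R * a <= m%:~R * a by rewrite ler_pM2r// ler_int lezD1.
      by rewrite intrD mulrDl mul1r; lra.
    have [h'|h'] := leP m' m; last first.
      have : (m + 1)%:~R * a <= m'%:~R * a by rewrite ler_pM2r// ler_int lezD1.
      by rewrite intrD mulrDl mul1r; lra.
    have e : m' = m by apply/eqP; rewrite eq_le h' h.
    by move: h1 h2; rewrite e; lra.
  by move=> h; exists m; apply/andP; split; lra.
have yc0 m t : tile a m t -> (t - m%:~R * a + b - a < c0) = false.
  rewrite /tile /= in_itv/= intrD mulrDl mul1r => /andP[t1 t2].
  by apply/negbTE; rewrite -leNgt; lra.
apply: (@not_frame_iff R a b c 0 c0 k k.+1) => //.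
- move=> u m t tm /(badE m t tm) B; rewrite cE per_diff// (yc0 _ _ tm) B.
  by rewrite mul1r mul0r subr0 subrK.
- move=> u m t tm nB; have B : (t - m%:~R * a < c0) = false.
    by apply/negP => h; apply: nB; exact/(badE m t tm).
  by rewrite cE per_diff// (yc0 _ _ tm) B !mul0r addr0 subr0.
- move=> u m t tm nB; have B : (t - m%:~R * a < c0) = false.
    by apply/negP => h; apply: nB; exact/(badE m t tm).
  by rewrite cE per_tile// B mul0r addr0.
- move=> m t nB; rewrite /chi0c; congr (if _ then _ else _); congr (_ && _).
  apply/idP/idP => h; last by rewrite [ltRHS]cE; lra.
  rewrite ltNge; apply/negP => h2; apply: nB; exists m.
  by move: h; rewrite [ltRHS]cE => h; apply/andP; split; lra.
Qed.

(** The window consists of exactly [k] periods, so the comparison of windows is trivial and the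
    slots may fill whole periods, [delta = b]. From [b < c] follows [k > 1], which leaves room for
    [r = 1]. *)
Lemma case_c0_eq0 : c0 = 0 -> ~ gabor_frame (chi0c c) (fun=> 0) a b.
Proof.
move=> c00; have ck : c = k%:R * b by rewrite cE c00 addr0.
have k1 : (1 < k)%N.
  by move: bc; rewrite ck -{1}[b]mul1r ltr_pM2r// ltr1n.
by apply: (@not_frame R a b c k.+1 k 1 0 b) => // l m t _ _; rewrite ck.
Qed.

End Cases.

Theorem theorem2p2 (R : realType) (a b c : R) :
  0 < a -> a < b -> b < c ->
  let k := Num.truncn (c / b) in
  let c0 := c - k%:R * b in
  let G_frame := gabor_frame (chi0c c) (fun _ => 0) a b in
  (* (VI) *)
  ((a <= c0 -> b - a < c0 ->
    (~ G_frame <->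
     exists p q : nat, [/\ (0 < p)%N, (0 < q)%N, coprime p q, a / b = p%:R / q%:R &
       ((c0 > b - (gcdn k.+1 p)%:R * b / q%:R /\ gcdn k.+1 p <> k.+1) \/
       (c0 > b - (gcdn k.+1 p)%:R * b / q%:R + b / q%:R /\ gcdn k.+1 p = k.+1))]))
  /\
  (* (VII) *)
   (c0 < a -> c0 <= b - a ->
    (~ G_frame <->
     c0 = 0 \/
     (exists p q : nat, [/\ (0 < p)%N, (0 < q)%N, coprime p q, a / b = p%:R / q%:R &
        0 < c0 < (gcdn k p)%:R * b / q%:R /\ gcdn k p <> k]) \/
     (exists p q : nat, [/\ (0 < p)%N, (0 < q)%N, coprime p q, a / b = p%:R / q%:R &
        0 < c0 < (gcdn k p)%:R * b / q%:R - b / q%:R /\ gcdn k p = k])))).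
Proof.
move=> a0 ab bc k c0 G_frame; have b0 : 0 < b by exact: lt_trans ab.
split=> [ac bac|ca cba].
  rewrite (case_VI a0 ab bc ac bac).
  by split=> -[p [q [p0 q0 cop E h]]]; exists p, q; split => //; move: h;
    rewrite -/k -/c0 mulrA => -[[h1 h2]|[h1 h2]]; [left|right|left|right]; split => //; lra.
have cb : 0 <= c / b by rewrite divr_ge0//; lra.
have c00 : 0 <= c0.
  by have /andP[h1 _] := truncn_itv cb; move: h1; rewrite ler_pdivlMr// /c0 subr_ge0.
have [e0|n0] := eqVneq c0 0.
  by split=> _; [left|exact: case_c0_eq0].
have cp : 0 < c0 by rewrite lt_neqAle eq_sym n0.
rewrite (case_VII a0 ab bc cp ca cba); split.
  move=> [p [q [p0 q0 cop E]]]; rewrite -/k -/c0 mulrA => -[[h1 h2]|[h1 h2]]; right; [left|right];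
    by exists p, q; split => //; rewrite cp h1.
case=> [e|[]]; first by rewrite e eqxx in n0.
  by move=> [p [q [p0 q0 cop E [/andP[_ h1] h2]]]]; exists p, q; split => //;
    rewrite mulrA; left.
by move=> [p [q [p0 q0 cop E [/andP[_ h1] h2]]]]; exists p, q; split => //;
  rewrite mulrA; right.
Qed.
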